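(* Let $\theta\in\mathbb{R}$ and let $\Lambda\subseteq\mathbb{R}$. Then $R_\theta(\mathbb{R}\times\Lambda)$ is a uniqueness set for the Gabor phase retrieval problem in $L^2(\mathbb{R})$ if and only if $\Lambda$ is not contained in an arithmetic progression.
   Context: An arithmetic progression is a set of the form $a\mathbb{Z}+b$ with $a,b\in\mathbb{R}$ (the choice $a=0$ is allowed). $R_\theta:\mathbb{R}^2\to\mathbb{R}^2$, $R_\theta(x,y)=(x\cos\theta-y\sin\theta,\ x\sin\theta+y\cos\theta)$, is the rotation by angle $\theta$. With $\varphi(t)=e^{-\pi t^2}$, the Gabor transform of $f\in L^2(\mathbb{R})$ (complex-valued) is $\mathcal{G}f(x,\omega)=\int_{\mathbb{R}} f(t)\varphi(t-x)e^{-2\pi i\omega t}\,dt$ for $(x,\omega)\in\mathbb{R}^2$. For complex-valued functions $f,h$ write $f\sim h$ if there is $\tau\in\mathbb{C}$, $|\tau|=1$, with $f=\tau h$ (equality almost everywhere for elements of $L^2(\mathbb{R})$). A set $\mathcal{U}\subseteq\mathbb{R}^2$ is a uniqueness set for the Gabor phase retrieval problem in $X\subseteq L^2(\mathbb{R})$ if for all $f,h\in X$: $|\mathcal{G}f(z)|=|\mathcal{G}h(z)|$ for all $z\in\mathcal{U}$ implies $f\sim h$. *)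

(* Defs.v *)
From mathcomp Require Import all_boot all_order all_algebra.
From mathcomp Require Import all_classical all_reals all_analysis.
From mathcomp Require Import complex.

Set Implicit Arguments.
Unset Strict Implicit.
Unset Printing Implicit Defensive.
Import Order.TTheory GRing.Theory Num.Theory.
Import numFieldNormedType.Exports.
Local Open Scope classical_set_scope.
Local Open Scope complex_scope.
Local Open Scope ring_scope.

(* a = 0 is allowed: singletons are arithmetic progressions. *)
Definition arith_prog (R : realType) (a b : R) : set R :=
  [set a * k%:~R + b | k in [set: int]].

Definition is_arith_prog (R : realType) (A : set R) : Prop :=
  exists a b : R, A = arith_prog a b.

Definition rotation (R : realType) (theta : R) (z : R * R) : R * R :=
  (z.1 * cos theta - z.2 * sin theta, z.1 * sin theta + z.2 * cos theta).

Definition expi (R : realType) (x : R) : R[i] := cos x +i* sin x.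

(* [Rintegral] is a total function (0 on a divergent integral); for f in L2 the
   integrand of [gabor] is absolutely integrable. *)
Definition cintegral (R : realType) (f : R -> R[i]) : R[i] :=
  (\int[@lebesgue_measure R]_t complex.Re (f t)) +i*
  (\int[@lebesgue_measure R]_t complex.Im (f t)).

Definition gauss_window (R : realType) (t : R) : R := expR (- (pi * t ^+ 2)).

Definition gabor (R : realType) (f : R -> R[i]) (z : R * R) : R[i] :=
  cintegral (fun t : R =>
    f t * (gauss_window (t - z.1))%:C * expi (- (2 * pi * z.2 * t))).

(* Elements of L2 are represented by Borel functions, which is harmless since
   every Lebesgue measurable function is almost everywhere equal to one; the
   identification of almost everywhere equal functions is made in
   [phase_equiv]. *)
Definition L2 (R : realType) : set (R -> R[i]) :=
  [set f : R -> R[i] | [/\ measurable_fun [set: R] (fun t : R => complex.Re (f t)),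
               measurable_fun [set: R] (fun t : R => complex.Im (f t)) &
               (\int[@lebesgue_measure R]_t
                  (ComplexField.Normc.normc (f t) ^+ 2)%:E < +oo)%E]].

Definition phase_equiv (R : realType) (f h : R -> R[i]) : Prop :=
  exists2 tau : R[i], `|tau| = 1 &
    {ae @lebesgue_measure R, forall t : R, f t = tau * h t}.

Definition uniqueness_set (R : realType) (X : set (R -> R[i]))
    (U : set (R * R)) : Prop :=
  forall f h : R -> R[i], X f -> X h ->
    (forall z, U z -> `|gabor f z| = `|gabor h z|) -> phase_equiv f h.

(* Main.v *)
Require Import Defs.
From mathcomp Require Import all_boot all_order all_algebra.
From mathcomp Require Import all_classical all_reals all_analysis.
From mathcomp Require Import measurable_realfun complex ring lra.
Local Open Scope classical_set_scope.
Local Open Scope ring_scope.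

(* Up to a nonvanishing factor, the Gabor transform of f at R_theta (x, l) is F (x - i l),
   where F is an entire function, namely a rotated and scaled Laplace transform of
   f (t) exp (- pi t^2). Write F* (z) for the conjugate of F at the conjugate of z. Equal
   moduli on the line with parameter l amount to F (z) F* (z + 2 i l) = H (z) H* (z + 2 i l),
   first on that line and then, by the identity theorem, everywhere. Dividing the identities
   for l and l', the quotient F* / H* has period 2 i (l' - l). If Lambda is not contained in
   an arithmetic progression, then the group of these periods is not discrete, so F* / H* is
   constant, and the uniqueness of Fourier transforms gives f ~ h.
   Conversely, let Lambda be contained in a Z + b with a <> 0, let Psi be the transform of a
   Gaussian and v = (2 pi / a) exp (i theta). Then Psi (Z + v) / Psi (Z) is, up to a
   constant, an exponential that is real on all the lines in question, so that
   Psi (Z) + i g Psi (Z + v) and Psi (Z) - i g Psi (Z + v) have the same modulus there for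
   a suitable constant g, although they are not proportional. *)

Set Implicit Arguments.
Unset Strict Implicit.
Unset Printing Implicit Defensive.
Import Order.TTheory GRing.Theory Num.Theory.
Import numFieldNormedType.Exports.
Local Open Scope complex_scope.

Local Notation nc := ComplexField.Normc.normc.
Local Notation Re := complex.Re.
Local Notation Im := complex.Im.

(** * Modulus, conjugation and the complex exponential *)

Section ComplexBasics.
Variable R : realType.
Implicit Types (x y : R) (z w u : R[i]).

Lemma Re_add z w : Re (z + w) = Re z + Re w. Proof. by case: z w => [? ?] []. Qed.
Lemma Im_add z w : Im (z + w) = Im z + Im w. Proof. by case: z w => [? ?] []. Qed.
Lemma Re_opp z : Re (- z) = - Re z. Proof. by case: z. Qed.
Lemma Im_opp z : Im (- z) = - Im z. Proof. by case: z. Qed.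
Lemma Re_mul z w : Re (z * w) = Re z * Re w - Im z * Im w.
Proof. by case: z w => [? ?] []. Qed.
Lemma Im_mul z w : Im (z * w) = Re z * Im w + Im z * Re w.
Proof. by case: z w => [? ?] []. Qed.
Lemma Re_conjc z : Re (conjc z) = Re z. Proof. by case: z. Qed.
Lemma Im_conjc z : Im (conjc z) = - Im z. Proof. by case: z. Qed.

Lemma complex_eqP z w : Re z = Re w -> Im z = Im w -> z = w.
Proof. by case: z w => [? ?] [? ?] /= -> ->. Qed.

Lemma normr_normc z : `|z| = (nc z)%:C. Proof. by []. Qed.

Lemma normc_ge0 z : 0 <= nc z.
Proof. by case: z => a b /=; exact: sqrtr_ge0. Qed.

Lemma sqr_normcE z : nc z ^+ 2 = Re z ^+ 2 + Im z ^+ 2.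
Proof. by case: z => a b /=; rewrite sqr_sqrtr// addr_ge0 ?sqr_ge0. Qed.

Lemma normc_real x : nc x%:C = `|x|.
Proof. by rewrite /= expr0n addr0 sqrtr_sqr. Qed.

Lemma normcX z n : nc (z ^+ n) = nc z ^+ n.
Proof.
elim: n => [|n IH]; first by rewrite !expr0 ComplexField.Normc.normc1.
by rewrite !exprS ComplexField.Normc.normcM IH.
Qed.

Lemma normc_eq0 z : (nc z == 0) = (z == 0).
Proof.
apply/eqP/eqP => [/ComplexField.Normc.eq0_normc//|->].
exact: ComplexField.Normc.normc0.
Qed.

Lemma normc_gt0 z : (0 < nc z) = (z != 0).
Proof. by rewrite lt_def normc_ge0 andbT normc_eq0. Qed.

Lemma normc_conjc z : nc (conjc z) = nc z.
Proof. by case: z => a b /=; rewrite sqrrN. Qed.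

Lemma le_normcB z w : nc (z - w) <= nc z + nc w.
Proof. by rewrite -[nc w]normcN; exact: le_normcD. Qed.

Lemma normc_sum_le (I : Type) (s : seq I) (F : I -> R[i]) :
  nc (\sum_(i <- s) F i) <= \sum_(i <- s) nc (F i).
Proof.
elim/big_ind2: _ => [|a b c d ab cd|//].
  by rewrite ComplexField.Normc.normc0.
by apply: le_trans (le_normcD _ _) _; rewrite lerD.
Qed.

Lemma normr_Re_le z : `|Re z| <= nc z.
Proof.
rewrite -(@ler_pXn2r _ 2)// ?nnegrE ?normc_ge0//.
by rewrite sqr_normcE real_normK ?num_real// lerDl sqr_ge0.
Qed.

Lemma normr_Im_le z : `|Im z| <= nc z.
Proof.
rewrite -(@ler_pXn2r _ 2)// ?nnegrE ?normc_ge0//.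
by rewrite sqr_normcE real_normK ?num_real// lerDr sqr_ge0.
Qed.

Lemma normc_le_ReIm z : nc z <= `|Re z| + `|Im z|.
Proof.
rewrite -(@ler_pXn2r _ 2)// ?nnegrE ?normc_ge0 ?addr_ge0//.
rewrite sqr_normcE sqrrD !real_normK ?num_real// lerD2r lerDl.
by rewrite mulrn_wge0// mulr_ge0.
Qed.

Lemma mulc_conjc z : z * conjc z = (nc z ^+ 2)%:C.
Proof.
apply: complex_eqP; rewrite ?Re_mul ?Im_mul Re_conjc Im_conjc/=.
  by rewrite sqr_normcE; ring.
by rewrite mulrN mulrC addNr.
Qed.

Definition cexp w : R[i] :=
  (expR (Re w) * cos (Im w)) +i* (expR (Re w) * sin (Im w)).

Lemma Re_cexp w : Re (cexp w) = expR (Re w) * cos (Im w).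
Proof. by []. Qed.
Lemma Im_cexp w : Im (cexp w) = expR (Re w) * sin (Im w).
Proof. by []. Qed.

Lemma cexpD z w : cexp (z + w) = cexp z * cexp w.
Proof.
apply: complex_eqP; rewrite ?Re_mul ?Im_mul ?Re_cexp ?Im_cexp Re_add Im_add expRD.
  by rewrite cosD; ring.
by rewrite sinD; ring.
Qed.

Lemma cexp0 : cexp 0 = 1.
Proof. by apply: complex_eqP; rewrite ?Re_cexp ?Im_cexp/= expR0 ?cos0 ?sin0; ring. Qed.

Lemma normc_cexp w : nc (cexp w) = expR (Re w).
Proof.
apply/eqP; rewrite -(@eqrXn2 _ 2)// ?normc_ge0 ?expR_ge0//.
rewrite sqr_normcE Re_cexp Im_cexp !exprMn -mulrDr cos2Dsin2.
by rewrite mulr1.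
Qed.

Lemma cexp_neq0 w : cexp w != 0.
Proof. by rewrite -normc_gt0 normc_cexp expR_gt0. Qed.

Lemma cexp_real x : cexp x%:C = (expR x)%:C.
Proof. by apply: complex_eqP; rewrite ?Re_cexp ?Im_cexp/= ?cos0 ?sin0; ring. Qed.

Lemma cexp_imag x : cexp ('i%C * x%:C) = expi x.
Proof.
have -> : 'i%C * x%:C = 0 +i* x by simpc.
by rewrite /cexp/expi/= expR0 !mul1r.
Qed.

End ComplexBasics.

(** * Taylor remainders of the complex exponential *)

Section CexpTaylor.
Variable R : realType.
Implicit Types (x y s : R) (z w u : R[i]).

Definition cexp_rem n w : R[i] :=
  cexp w - \sum_(k < n) w ^+ k / k`!%:R.

Lemma cexp_rem_at0 n : cexp_rem n.+1 0 = 0 :> R[i].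
Proof.
rewrite /cexp_rem cexp0 big_ord_recl/= expr0 fact0 divr1.
rewrite big1 ?addr0 ?subrr// => i _.
by rewrite expr0n mul0r.
Qed.

Lemma is_derive_monomial n (c t : R) :
  is_derive t 1 (fun r : R => r ^+ n.+1 * c) (n.+1%:R * t ^+ n * c).
Proof.
have -> : (fun r : R => r ^+ n.+1 * c) = horner (c *: 'X^(n.+1) : {poly R}).
  by apply/funext => r; rewrite hornerZ hornerXn mulrC.
apply: is_derive_eq; rewrite derivZ derivXn hornerZ hornerMn hornerXn/=.
by rewrite -mulr_natl; ring.
Qed.

(** Along the ray through [w], differentiation lowers the order of the remainder by one and
    multiplies it by [w]. Pairing with [u] and taking real parts keeps all derivatives
    real-valued. *)
Lemma is_derive_cexp_rem n w u s :
  is_derive s 1 (fun t : R => Re (u * cexp_rem n.+1 (t%:C * w)))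
    (Re (u * w * cexp_rem n (s%:C * w))).
Proof.
have base (v : R[i]) (t : R) : is_derive t 1 (fun t : R => Re (v * cexp_rem 0 (t%:C * w)))
    (Re (v * w * cexp_rem 0 (t%:C * w))).
  case: w v => [x y] [a b].
  have -> : (fun t : R => Re ((a +i* b) * cexp_rem 0 (t%:C * (x +i* y)))) =
      (fun t : R => a * (expR (t * x) * cos (t * y)) -
                    b * (expR (t * x) * sin (t * y))).
    apply/funext => r; rewrite /cexp_rem big_ord0 subr0 Re_mul/=.
    by rewrite !mul0r subr0 addr0.
  rewrite /cexp_rem big_ord0 subr0 !Re_mul Im_mul/= !mul0r subr0 addr0.
  apply: is_derive_eq.
  rewrite /GRing.scale/=; ring.
have real_pow k (t : R) : t%:C ^+ k = (t ^+ k)%:C :> R[i] by rewrite rmorphXn.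
(* The last Taylor term splits off; on the ray it is a real power of [t] times a constant. *)
have E m (v : R[i]) (t : R) : Re (v * cexp_rem m.+1 (t%:C * w)) =
    Re (v * cexp_rem m (t%:C * w)) - t ^+ m * Re (v * (w ^+ m / m`!%:R)).
  rewrite /cexp_rem big_ord_recr/= opprD addrA mulrDr Re_add mulrN Re_opp.
  congr (_ - _); rewrite exprMn real_pow.
  have -> : v * ((t ^+ m)%:C * w ^+ m / m`!%:R) =
     (t ^+ m)%:C * (v * (w ^+ m / m`!%:R)) by ring.
  by rewrite Re_mul/= mul0r subr0.
elim: n u s => [|n IH] u s.
  have -> : (fun t : R => Re (u * cexp_rem 1 (t%:C * w))) =
     (fun t : R => Re (u * cexp_rem 0 (t%:C * w)) - t ^+ 0 * Re (u * (w ^+ 0 / 0`!%:R))).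
    by apply/funext => t; rewrite E.
  have H := base u s.
  under eq_fun do rewrite expr0 mul1r.
  by apply: (is_derive_eq (is_deriveB H (is_derive_cst _ _ _))); rewrite subr0.
have -> : (fun t : R => Re (u * cexp_rem n.+2 (t%:C * w))) =
     (fun t : R => Re (u * cexp_rem n.+1 (t%:C * w)) -
                   t ^+ n.+1 * Re (u * (w ^+ n.+1 / (n.+1)`!%:R))).
  by apply/funext => t; rewrite E.
have H := IH u s.
set c := Re (u * (w ^+ n.+1 / _)).
have H2 := is_derive_monomial n c s.
apply: (is_derive_eq (is_deriveB H H2)).
rewrite E; congr (_ - _); rewrite /c.
have -> : u * w * (w ^+ n / n`!%:R) = (n.+1%:R)%:C * (u * (w ^+ n.+1 / n.+1`!%:R)).
  have -> : (n.+1%:R : R)%:C = n.+1%:R :> R[i] by rewrite rmorph_nat.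
  rewrite factS natrM exprS; field.
  by rewrite nat1r !pnatr_eq0 -!lt0n fact_gt0.
by rewrite [in RHS]Re_mul/= mul0r subr0; ring.
Qed.

Lemma le_derive_ge0 (f f' : R -> R) s : 0 <= s ->
  (forall t : R, is_derive t 1 f (f' t)) -> (forall t, 0 <= t <= s -> 0 <= f' t) ->
  f 0 <= f s.
Proof.
move=> s0 df f'0.
have cf : {within `[0, s], continuous f}.
  apply: continuous_subspaceT => t.
  by apply: differentiable_continuous; apply/derivable1_diffP; case: (df t).
have [c cs fE] := @MVT_segment R f f' 0 s s0 (fun t _ => df t) cf.
rewrite -subr_ge0 fE subr0 mulr_ge0//; apply: f'0.
by move: cs; rewrite in_itv.
Qed.

(** Induction on [n] integrates the estimate along the ray: bound minus remainder vanishes at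
    [s = 0], and its derivative is nonnegative by the bound of the previous order. The factor [u]
    varies in the induction, since differentiation replaces it by [u * w]. *)
Lemma Re_cexp_rem_le n w u s : 0 <= s <= 1 ->
  Re (u * cexp_rem n (s%:C * w)) <=
  nc u * nc w ^+ n * expR (nc w) * (s ^+ n / n`!%:R).
Proof.
elim: n u s => [|n IH] u s /andP[s0 s1].
  rewrite !expr0 fact0 divr1 !mulr1 /cexp_rem big_ord0 subr0.
  apply: le_trans (ler_norm _) _; apply: le_trans (normr_Re_le _) _.
  rewrite ComplexField.Normc.normcM ler_wpM2l ?normc_ge0//.
  rewrite normc_cexp ler_expR Re_mul/= mul0r subr0.
  apply: le_trans (ler_norm _) _; rewrite normrM ger0_norm//.
  by rewrite -[leRHS]mul1r ler_pM// normr_Re_le.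
set K := nc u * nc w ^+ n.+1 * expR (nc w).
pose f t : R := K * (t ^+ n.+1 / (n.+1)`!%:R) - Re (u * cexp_rem n.+1 (t%:C * w)).
pose f' t : R := K * (t ^+ n / n`!%:R) - Re (u * w * cexp_rem n (t%:C * w)).
suff : f 0 <= f s.
  by rewrite /f exprS mul0r mul0r mulr0 mul0r cexp_rem_at0 mulr0 subr0 subr_ge0.
apply: (@le_derive_ge0 f f') => //.
  move=> t; rewrite /f /f'.
  have H := is_derive_cexp_rem n w u t.
  have H2 : is_derive t 1 (fun t : R => K * (t ^+ n.+1 / (n.+1)`!%:R))
      (K * (t ^+ n / n`!%:R)).
    under eq_fun do rewrite mulrCA.
    apply: is_derive_eq (is_derive_monomial n (K / (n.+1)`!%:R) t) _.
    rewrite factS natrM; field.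
    by rewrite nat1r !pnatr_eq0 -!lt0n fact_gt0.
  exact: is_deriveB.
move=> t /andP[t0 ts]; rewrite /f' subr_ge0.
have t1 : 0 <= t <= 1 by rewrite t0 (le_trans ts).
apply: le_trans (IH _ _ t1) _.
by rewrite ComplexField.Normc.normcM /K exprS !mulrA.
Qed.

Lemma cexp_rem_le n w :
  nc (cexp_rem n w) <= nc w ^+ n / n`!%:R * expR (nc w).
Proof.
have [->|r0] := eqVneq (cexp_rem n w) 0.
  rewrite ComplexField.Normc.normc0 mulr_ge0 ?expR_ge0// divr_ge0// exprn_ge0//.
  exact: normc_ge0.
(* Taking [u] to be the conjugate of the remainder turns the real part into a squared modulus, one
   factor of which cancels. *)
have /(@Re_cexp_rem_le n w (conjc (cexp_rem n w))) : 0 <= (1 : R) <= 1.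
  by rewrite ler01 lexx.
rewrite mul1r mulrC mulc_conjc/= normc_conjc expr1n mul1r.
rewrite expr2 -!mulrA ler_pM2l ?normc_gt0//.
by rewrite [expR _ * _]mulrC mulrA.
Qed.

End CexpTaylor.

(** * Everywhere convergent power series *)

Section PowerSeries.
Variable R : realType.
Implicit Types (r M : R) (z w : R[i]) (c d : nat -> R[i]) (F H : R[i] -> R[i]).

Definition psum c n z : R[i] := \sum_(k < n) c k * z ^+ k.

(* The geometric remainder estimate is equivalent to F being the sum of an
   everywhere convergent power series, and passes to products directly. *)
Definition expansion F c : Prop := forall r, 0 < r -> exists M,
  forall n z, nc z <= r -> nc (F z - psum c n z) <= M * (nc z / r) ^+ n.

Definition power_series F : Prop := exists c, expansion F c.

Lemma ratio_bound r z : 0 < r -> nc z <= r -> 0 <= nc z / r <= 1.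
Proof.
by move=> r0 zr; rewrite ler_pdivrMr// mul1r zr andbT divr_ge0 ?normc_ge0// ltW.
Qed.

Lemma expansion_bound_ge0 F c r M : 0 < r ->
  (forall n z, nc z <= r -> nc (F z - psum c n z) <= M * (nc z / r) ^+ n) ->
  0 <= M.
Proof.
move=> r0 /(_ 0%N 0); rewrite ComplexField.Normc.normc0 expr0 mulr1.
by move=> /(_ (ltW r0)); apply: le_trans; exact: normc_ge0.
Qed.

(** The term is the difference of two consecutive remainders. *)
Lemma expansion_term F c r M : 0 < r ->
  (forall n z, nc z <= r -> nc (F z - psum c n z) <= M * (nc z / r) ^+ n) ->
  forall n z, nc z <= r -> nc (c n * z ^+ n) <= (M + M) * (nc z / r) ^+ n.
Proof.
move=> r0 HM n z zr; have M0 := expansion_bound_ge0 r0 HM.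
have -> : c n * z ^+ n = (F z - psum c n z) - (F z - psum c n.+1 z).
  by rewrite /psum big_ord_recr/=; ring.
apply: le_trans (le_normcB _ _) _; rewrite mulrDl lerD ?HM//.
apply: le_trans (HM n.+1 z zr) _; rewrite ler_wpM2l//.
have /andP[? ?] := ratio_bound r0 zr.
by rewrite exprS ler_piMl// exprn_ge0.
Qed.

Lemma power_series_cst (a : R[i]) : power_series (fun=> a).
Proof.
exists (fun k => if k == 0%N then a else 0) => r r0; exists (nc a) => -[|n] z zr.
  by rewrite /psum big_ord0 subr0 expr0 mulr1.
rewrite /psum big_ord_recl/= expr0 mulr1 big1 => [|i _]; last by rewrite mul0r.
rewrite addr0 subrr ComplexField.Normc.normc0 mulr_ge0 ?normc_ge0//.
by rewrite exprn_ge0//; case/andP: (ratio_bound r0 zr).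
Qed.

Lemma power_seriesB F H : power_series F -> power_series H ->
  power_series (fun z => F z - H z).
Proof.
move=> [c Fc] [d Hd]; exists (fun k => c k - d k) => r r0.
have [M HM] := Fc r r0; have [N HN] := Hd r r0; exists (M + N) => n z zr.
have -> : F z - H z - psum (fun k => c k - d k) n z =
    (F z - psum c n z) - (H z - psum d n z).
  rewrite /psum; under eq_bigr do rewrite mulrBl.
  by rewrite big_split/= sumrN; ring.
apply: le_trans (le_normcB _ _) _; rewrite mulrDl lerD ?HM ?HN//.
Qed.

Lemma power_series_conj F : power_series F ->
  power_series (fun z => conjc (F (conjc z))).
Proof.
move=> [c Fc]; exists (fun k => conjc (c k)) => r r0.
have [M HM] := Fc r r0; exists M => n z zr.
rewrite -[nc z]normc_conjc; apply: le_trans (HM _ _ _); rewrite ?normc_conjc//.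
rewrite -[leRHS]normc_conjc rmorphB/= /psum rmorph_sum/=.
under [in leRHS]eq_bigr do rewrite rmorphM rmorphXn/= conjcK.
by [].
Qed.

Lemma power_series_scale F (a : R[i]) : power_series F ->
  power_series (fun z => F (a * z)).
Proof.
move=> [c Fc]; exists (fun k => c k * a ^+ k) => r r0.
(* The added 1 keeps the radius positive when [a = 0]. *)
have ar0 : 0 < (nc a + 1) * r by rewrite mulr_gt0// ltr_wpDl ?normc_ge0.
have [M HM] := Fc _ ar0; exists M => n z zr.
have M0 := expansion_bound_ge0 ar0 HM.
have azr : nc (a * z) <= (nc a + 1) * r.
  by rewrite ComplexField.Normc.normcM ler_pM ?normc_ge0// lerDl.
have -> : psum (fun k => c k * a ^+ k) n z = psum c n (a * z).
  by apply: eq_bigr => k _; rewrite exprMn mulrA.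
apply: le_trans (HM n _ azr) _; rewrite ler_wpM2l// lerXn2r// ?nnegrE.
- by rewrite divr_ge0 ?normc_ge0// ltW.
- by rewrite divr_ge0 ?normc_ge0// ltW.
rewrite ComplexField.Normc.normcM invfM mulrACA ler_piMl//.
  by rewrite divr_ge0 ?normc_ge0// ltW.
by rewrite ler_pdivrMr ?mul1r ?lerDl// ltr_wpDl ?normc_ge0.
Qed.

Definition cauchy_coef c d n : R[i] := \sum_(i < n.+1) c i * d (n - i)%N.

(** The triangle i + j < n of products is summed by rows. *)
Lemma psum_cauchy c d n z :
  psum (cauchy_coef c d) n z = \sum_(i < n) c i * z ^+ i * psum d (n - i) z.
Proof.
elim: n => [|n IH]; first by rewrite /psum !big_ord0.
rewrite /psum big_ord_recr/= -/(psum _ n z) IH /cauchy_coef.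
rewrite [RHS]big_ord_recr/= subSnn big_ord_recr/= subnn big_ord1 expr0 mulr1.
rewrite mulrDl addrA; congr (_ + _); last by ring.
rewrite mulr_suml -big_split/=; apply: eq_bigr => i _.
rewrite subSn 1?ltnW// big_ord_recr/= mulrDr; congr (_ + _).
have -> : z ^+ n = z ^+ i * z ^+ (n - i) by rewrite -exprD subnKC// ltnW.
by ring.
Qed.

Lemma natr_ratio_half n : n%:R * (2^-1 : R) ^+ n <= 1.
Proof.
rewrite exprVn ler_pdivrMr ?exprn_gt0// mul1r -natrX ler_nat.
by rewrite ltnW// ltn_expl.
Qed.

(** The remainder of the product is the remainder of [F] times [H], plus [n] products of a term of
    [F] with a remainder of [H], each bounded by a constant times q^n. Working on the radius 2 r
    halves the ratio, and the resulting 2^-n absorbs the factor [n]. *)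
Lemma power_seriesM F H : power_series F -> power_series H ->
  power_series (fun z => F z * H z).
Proof.
move=> [c Fc] [d Hd]; exists (cauchy_coef c d) => r r0.
have r20 : 0 < 2 * r by rewrite mulr_gt0.
have [M HM] := Fc _ r20; have [N HN] := Hd _ r20.
have M0 := expansion_bound_ge0 r20 HM; have N0 := expansion_bound_ge0 r20 HN.
exists (M * N + (M + M) * N) => n z zr.
have zr2 : nc z <= 2 * r by rewrite (le_trans zr)// ler_peMl ?ltW// ltr1n.
set q := nc z / (2 * r); set p := nc z / r.
have qE : q = 2^-1 * p by rewrite /q /p invfM; ring.
have /andP[q0 q1] : 0 <= q <= 1 by exact: ratio_bound.
have p0 : 0 <= p by case/andP: (ratio_bound r0 zr).
have qn : q ^+ n <= p ^+ n.
  by rewrite lerXn2r// qE ler_piMl// invf_le1// ler1n.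
have nqn : n%:R * q ^+ n <= p ^+ n.
  by rewrite qE exprMn mulrA ler_piMl ?exprn_ge0//; exact: natr_ratio_half.
have -> : F z * H z - psum (cauchy_coef c d) n z =
    (F z - psum c n z) * H z +
    \sum_(i < n) c i * z ^+ i * (H z - psum d (n - i) z).
  rewrite psum_cauchy; under [in RHS]eq_bigr do rewrite mulrBr.
  by rewrite big_split/= sumrN -mulr_suml -/(psum c n z); ring.
apply: le_trans (le_normcD _ _) _; rewrite [leRHS]mulrDl lerD//.
  rewrite ComplexField.Normc.normcM [M * N * _]mulrAC.
  rewrite ler_pM ?normc_ge0//.
    by apply: le_trans (HM _ _ zr2) _; rewrite ler_wpM2l.
  by have := HN 0%N z zr2; rewrite /psum big_ord0 subr0 expr0 mulr1.
apply: le_trans (normc_sum_le _ _) _.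
apply: (@le_trans _ _ (\sum_(i < n) ((M + M) * N * q ^+ n))).
  apply: ler_sum => i _; rewrite ComplexField.Normc.normcM.
  have -> : q ^+ n = q ^+ i * q ^+ (n - i) by rewrite -exprD subnKC// ltnW.
  rewrite mulrACA.
  rewrite ler_pM ?normc_ge0//; last exact: HN.
  exact: expansion_term HM _ _ zr2.
rewrite sumr_const card_ord -mulr_natl mulrCA ler_wpM2l//.
by rewrite mulr_ge0// addr_ge0.
Qed.

(** If [c n] were the first nonzero coefficient, then at a zero z near 0 the remainder of order n +
    1 would give |c n| |z|^n <= M |z|^(n+1), which fails for small |z| > 0. *)
Lemma expansion_eq0 F c : expansion F c ->
  (forall e : R, 0 < e -> exists2 z, 0 < nc z < e & F z = 0) ->
  forall n, c n = 0.
Proof.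
move=> Fc zeros; elim/ltn_ind => n IH; apply/eqP; rewrite -normc_eq0.
have [M HM] := Fc 1 ltr01; have M0 := expansion_bound_ge0 ltr01 HM.
apply/negPn/negP => cn0.
have cn : 0 < nc (c n) by rewrite lt_def cn0 normc_ge0.
have M1 : 0 < M + 1 by rewrite ltr_wpDl.
have [|z /andP[z0 ze] Fz] := zeros (Num.min 1 (nc (c n) / (M + 1))).
  by rewrite lt_min ltr01 divr_gt0.
move: ze; rewrite lt_min => /andP[z1 zc].
have := HM n.+1 z (ltW z1).
rewrite Fz /psum big_ord_recr/= big1 => [|i _]; last by rewrite IH ?mul0r.
rewrite divr1 !add0r normcN ComplexField.Normc.normcM normcX exprS mulrA.
rewrite ler_pM2r ?exprn_gt0// leNgt => /negP; apply.
rewrite -(@ltr_pM2r _ (M + 1)^-1) ?invr_gt0//; apply: le_lt_trans zc.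
by rewrite mulrAC ler_piMl ?normc_ge0// ler_pdivrMr// mul1r lerDl.
Qed.

Lemma le0_geometric (x M : R) : (forall n, x <= M * 2^-1 ^+ n) -> x <= 0.
Proof.
move=> h; rewrite leNgt; apply/negP => x0.
have M0 : 0 <= M by have := h 0%N; rewrite expr0 mulr1; apply: le_trans; exact: ltW.
pose n := Num.bound (M / x).
have Mx : M / x < n%:R by rewrite archi_boundP// divr_ge0// ltW.
have := h n; rewrite exprVn ler_pdivlMr ?exprn_gt0//; apply/negP; rewrite -ltNge.
rewrite -ltr_pdivrMl// mulrC; apply: lt_trans Mx _.
by rewrite -natrX ltr_nat ltn_expl.
Qed.

Lemma power_series_eq0 F : power_series F ->
  (forall e : R, 0 < e -> exists2 z, 0 < nc z < e & F z = 0) ->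
  forall z, F z = 0.
Proof.
move=> [c Fc] zeros z; have c0 := expansion_eq0 Fc zeros.
(* On this radius the ratio is at most 1/2, and every remainder is [F z] itself because all
   coefficients vanish. *)
have r0 : 0 < 2 * (nc z + 1) by rewrite mulr_gt0// ltr_wpDl ?normc_ge0.
have [M HM] := Fc _ r0; have M0 := expansion_bound_ge0 r0 HM.
apply/eqP; rewrite -normc_eq0 eq_le normc_ge0 andbT.
apply: (@le0_geometric _ M) => n.
have z1 : nc z <= nc z + 1 by rewrite lerDl.
have zr : nc z <= 2 * (nc z + 1).
  by rewrite (le_trans z1)// ler_peMl ?ler1n// addr_ge0 ?normc_ge0.
have := HM n z zr; rewrite /psum big1 => [|i _]; last by rewrite c0 mul0r.
rewrite subr0 => /le_trans; apply; rewrite ler_wpM2l// lerXn2r// ?nnegrE//.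
  by rewrite divr_ge0 ?normc_ge0// ltW.
by rewrite ler_pdivrMr// mulrA mulVf ?mul1r ?pnatr_eq0.
Qed.

End PowerSeries.

(** * Entire functions and the identity theorem *)

Section Entire.
Variable R : realType.
Implicit Types (e : R) (z w : R[i]) (F H : R[i] -> R[i]).

(* Stating the expansion at every center spares the re-expansion of power series;
   for the transforms below, a translation only changes the kernel. *)
Definition entire F : Prop := forall w, power_series (fun z => F (w + z)).

Lemma entire_cst (a : R[i]) : entire (fun=> a).
Proof. by move=> w; exact: power_series_cst. Qed.

Lemma entireB F H : entire F -> entire H -> entire (fun z => F z - H z).
Proof. by move=> Fe He w; exact: power_seriesB. Qed.

Lemma entireM F H : entire F -> entire H -> entire (fun z => F z * H z).
Proof. by move=> Fe He w; exact: power_seriesM. Qed.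

Lemma entire_shift F a : entire F -> entire (fun z => F (z + a)).
Proof.
move=> Fe w; rewrite (_ : (fun z => _) = (fun z => F (w + a + z))) //.
by apply/funext => z; rewrite addrAC.
Qed.

Lemma entire_conj F : entire F -> entire (fun z => conjc (F (conjc z))).
Proof.
move=> Fe w; under eq_fun do rewrite rmorphD.
exact: power_series_conj (Fe _).
Qed.

Lemma entire_scale F a : entire F -> entire (fun z => F (a * z)).
Proof.
move=> Fe w; under eq_fun do rewrite mulrDr.
exact: power_series_scale (Fe _).
Qed.

(** No connectedness argument is involved: the expansion at [w] represents [F] on the whole
    plane. *)
Lemma entire_eq0 F w : entire F ->
  (forall e, 0 < e -> exists2 z, 0 < nc (z - w) < e & F z = 0) ->
  forall z, F z = 0.
Proof.
move=> Fe zeros z; rewrite -(subrKC w z).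
apply: (power_series_eq0 (Fe w)) => e e0.
by have [u uw Fu] := zeros _ e0; exists (u - w); rewrite ?subrKC.
Qed.

Lemma entire_eq0_line F w : entire F ->
  (forall x : R, F (x%:C + w) = 0) -> forall z, F z = 0.
Proof.
move=> Fe F0; apply: (entire_eq0 (w := w)) => // e e0.
exists ((e / 2)%:C + w) => //.
by rewrite addrK normc_real gtr0_norm ?divr_gt0//= gtr_pMr// invf_lt1 ?ltr1n.
Qed.

(** Entire functions form an integral domain. Zeros of [H] accumulate at a point [w] where [F] does
    not vanish, as otherwise zeros of [F] would accumulate there and [F] would be 0. *)
Lemma entire_mul_eq0 F H : entire F -> entire H ->
  (forall z, F z * H z = 0) -> (forall z, F z = 0) \/ (forall z, H z = 0).
Proof.
move=> Fe He FH; have [?|/existsNP[w Fw]] := pselect (forall z, F z = 0).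
  by left.
right; apply: (entire_eq0 (w := w)) => // e e0; apply: contrapT => noH.
apply: Fw; apply: (entire_eq0 (w := w)) => // d d0.
have m0 : 0 < Num.min d e by rewrite lt_min d0.
exists (w + (Num.min d e / 2)%:C).
  rewrite [w + _]addrC addrK normc_real gtr0_norm ?divr_gt0//=.
  rewrite ltr_pdivrMr//; apply: (@le_lt_trans _ _ d); first by rewrite ge_min lexx.
  by rewrite ltr_pMr// ltr1n.
apply/eqP; have /eqP := FH (w + (Num.min d e / 2)%:C).
rewrite mulf_eq0 => /orP[//|/eqP Hz]; exfalso; apply: noH.
exists (w + (Num.min d e / 2)%:C) => //.
rewrite [w + _]addrC addrK normc_real gtr0_norm ?divr_gt0//=.
rewrite ltr_pdivrMr//; apply: (@le_lt_trans _ _ e).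
  by rewrite ge_min lexx orbT.
by rewrite ltr_pMr// ltr1n.
Qed.

Lemma entire_cancel F H K : entire F -> entire H -> entire K ->
  ~ (forall z, F z = 0) -> (forall z, F z * H z = F z * K z) ->
  forall z, H z = K z.
Proof.
move=> Fe He Ke F0 E z; have := entire_mul_eq0 Fe (entireB He Ke).
case=> [u|//|HK]; first by rewrite mulrBr E subrr.
by apply/eqP; rewrite -subr_eq0 HK.
Qed.

End Entire.

(** * Discrete subgroups of the real line *)

Section DiscreteSubgroup.
Variable R : realType.

(** The generator is the infimum of the positive elements, or 0 if there are none. *)
Lemma discrete_subgroup (S : set R) (e : R) : 0 < e ->
  S 0 -> (forall x y, S x -> S y -> S (x - y)) ->
  (forall x, S x -> 0 < x -> e <= x) ->
  exists a, forall x, S x -> exists k : int, x = a * k%:~R.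
Proof.
move=> e0 S0 SB Se.
have SN x : S x -> S (- x) by move=> Sx; rewrite -sub0r; exact: SB.
have SD x y : S x -> S y -> S (x + y) by move=> Sx /SN /(SB _ _ Sx); rewrite opprK.
have Sn x n : S x -> S (x * n%:R).
  by move=> Sx; elim: n => [|n IH]; rewrite ?mulr0// -natr1 mulrDr mulr1; exact: SD.
have Sz x (k : int) : S x -> S (x * k%:~R).
  by move=> Sx; case: k => n; [exact: Sn | rewrite NegzE mulrNz mulrN; exact/SN/Sn].
have [triv|/existsNP[p /not_implyP[Sp p0]]] :=
    pselect (forall x, S x -> ~ (0 < x)).
  exists 0 => x Sx; exists 0; rewrite mul0r; apply/eqP; rewrite eq_le.
  have := triv _ Sx; have := triv _ (SN _ Sx).
  by rewrite oppr_gt0 => /negP; rewrite -leNgt => -> /negP; rewrite -leNgt => ->.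
have {}p0 : 0 < p by apply: contrapT.
pose P := S `&` [set x | 0 < x].
have Pinf : has_inf P by split; [exists p | exists 0 => x [_ /ltW]].
set a := inf P.
(* The infimum is attained: an element [s] within [e] of it is the least one, because a smaller
   positive [y] would yield the positive element [s - y] below [e]. *)
have Pa : P a.
  have [s Ps sa] := inf_adherent e0 Pinf.
  suff -> : a = s by [].
  apply/eqP; rewrite eq_le ge_inf//=; last by case: Pinf.
  apply: lb_le_inf; first by case: Pinf.
  move=> y Py; rewrite leNgt; apply/negP => ys.
  have ay : a <= y by apply: ge_inf => //; case: Pinf.
  have Ssy : S (s - y) by apply: SB; [case: Ps | case: Py].
  have := Se _ Ssy; rewrite subr_gt0 => /(_ ys).
  by rewrite leNgt ltrBlDr => /negP; apply; rewrite (lt_le_trans sa)// addrC lerD2l.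
have [Sa a0] := Pa.
(* Euclidean division: the remainder lies in [S] and in [0, a), so it is 0 by minimality of [a]. *)
exists a => x Sx; exists (Num.floor (x / a)); apply/eqP; rewrite -subr_eq0.
set r := x - _.
have Sr : S r by apply: SB => //; exact: Sz.
have /andP[r0 ra] : 0 <= r < a.
  have /andP[lo hi] := mem_rg1_floor (x / a).
  rewrite /r subr_ge0 ltrBlDr; apply/andP; split.
    by move: lo; rewrite ler_pdivlMr// mulrC.
  by move: hi; rewrite ltr_pdivrMr// mulrDl mul1r addrC mulrC.
rewrite eq_le r0 andbT leNgt; apply/negP => rgt0.
have : a <= r by apply: ge_inf; [case: Pinf | split].
by rewrite leNgt ra.
Qed.

End DiscreteSubgroup.

(** * Phase retrieval for entire functions from parallel lines *)

Section EntirePhaseRetrieval.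
Variable R : realType.

(** Identities between quotients are cross-multiplied, and common factors are removed by
    [entire_cancel], so that zeros cause no trouble. *)
Lemma entire_phase_retrieval (F H : R[i] -> R[i]) (Lambda : set R) :
  entire F -> entire H ->
  ~ (exists2 A : set R, is_arith_prog A & Lambda `<=` A) ->
  (forall x l, Lambda l ->
     nc (F (x%:C - 'i%C * l%:C)) = nc (H (x%:C - 'i%C * l%:C))) ->
  exists2 tau, nc tau = 1 & forall z, F z = tau * H z.
Proof.
move=> Fe He notAP FH.
(* The empty set lies in a progression, so at least one line is given. *)
have [l0 Ll0] : exists l, Lambda l.
  apply: contrapT => noL; apply: notAP; exists (arith_prog 0 0).
    by exists 0, 0.
  by move=> l Ll; exfalso; apply: noL; exists l.
pose it (t : R) : R[i] := 'i%C * t%:C.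
have itD t s : it (t + s) = it t + it s by rewrite /it rmorphD mulrDr.
have itN t : it (- t) = - it t by rewrite /it rmorphN mulrN.
pose Fs z := conjc (F (conjc z)); pose Hs z := conjc (H (conjc z)).
have Fse : entire Fs by exact: entire_conj.
have Hse : entire Hs by exact: entire_conj.
(* For z on the line of parameter [l], the conjugate of z + 2 i l is z, so the product is a squared
   modulus. *)
have star (K : R[i] -> R[i]) (x l : R) :
    K (x%:C - it l) * conjc (K (conjc (x%:C - it l + it (l + l)))) =
    (nc (K (x%:C - it l)) ^+ 2)%:C.
  rewrite -mulc_conjc; congr (_ * conjc (K _)).
  by rewrite itD addrA subrK /it; apply: complex_eqP;
    rewrite ?Re_conjc ?Im_conjc !(Re_add, Im_add, Re_opp, Im_opp, Re_mul, Im_mul)/=; ring.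
have key l : Lambda l -> forall z, F z * Fs (z + it (l + l)) = H z * Hs (z + it (l + l)).
  move=> Ll z; apply/eqP; rewrite -subr_eq0; apply/eqP; move: z.
  apply: (@entire_eq0_line _ _ (- it l)).
    by apply: entireB; apply: entireM => //; exact: entire_shift.
  by move=> x; rewrite /Fs /Hs !star FH// subrr.
have [H0|Hn0] := pselect (forall z, H z = 0).
  exists 1; first exact: ComplexField.Normc.normc1.
  move=> z; rewrite H0 mulr0.
  have [|F0|Fs0] := entire_mul_eq0 Fe (entire_shift (it (l0 + l0)) Fse).
  - by move=> w; rewrite key// H0 mul0r.
  - exact: F0.
  - have := Fs0 (conjc z - it (l0 + l0)); rewrite subrK /Fs conjcK => /eqP.
    by rewrite conjc_eq0 => /eqP.
have Hsn0 : ~ forall z, Hs z = 0.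
  move=> h; apply: Hn0 => z; have /eqP := h (conjc z).
  by rewrite /Hs conjcK conjc_eq0 => /eqP.
have Fn0 : ~ forall z, F z = 0.
  move=> F0; have [|//|Hs0] := entire_mul_eq0 He (entire_shift (it (l0 + l0)) Hse).
    by move=> w; rewrite -key// F0 mul0r.
  by apply: Hsn0 => z; have := Hs0 (z - it (l0 + l0)); rewrite subrK.
have FHn0 : ~ forall z, F z * H z = 0 by move=> /(entire_mul_eq0 Fe He)[].
(* the imaginary periods of Fs / Hs *)
pose S : set R := [set t | forall z, Fs (z + it t) * Hs z = Fs z * Hs (z + it t)].
(* Multiplying the identities for [l] and [l'] crosswise and cancelling [F * H] leaves a relation
   between [Fs] and [Hs] alone; translating it by - 2 i l exhibits the period. *)
have SL l l' : Lambda l -> Lambda l' -> S ((l' + l') - (l + l)).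
  move=> Ll Ll' z.
  have E : forall z, Fs (z + it (l + l)) * Hs (z + it (l' + l')) =
                     Hs (z + it (l + l)) * Fs (z + it (l' + l')).
    apply: (entire_cancel (entireM Fe He)) => //.
    - by apply: entireM; exact: entire_shift.
    - by apply: entireM; exact: entire_shift.
    - move=> w; have k1 := key _ Ll w; have k2 := key _ Ll' w.
      transitivity ((F w * Fs (w + it (l + l))) * (H w * Hs (w + it (l' + l')))).
        by ring.
      by rewrite k1 -k2; ring.
  have -> : z + it (l' + l' - (l + l)) = z - it (l + l) + it (l' + l').
    by rewrite (itD (l' + l')) itN; ring.
  by have := E (z - it (l + l)); rewrite subrK => ->; rewrite mulrC.
have S0 : S 0 by move=> z; rewrite /it mulr0 addr0.
(* The relations for [t] at z and for [t'] at z + i (t - t') share the point z + i t, where [Hs] is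
   cancelled. *)
have SB t t' : S t -> S t' -> S (t - t').
  move=> St St' z; move: z; apply: (entire_cancel (entire_shift (it t) Hse)).
  - by apply: entireM => //; exact: entire_shift.
  - by apply: entireM => //; exact: entire_shift.
  - by move=> h; apply: Hsn0 => z; have := h (z - it t); rewrite subrK.
  move=> z; have := St' (z + it (t - t')).
  rewrite (itD t) itN addrA subrK => k1; have k2 := St z.
  transitivity ((Fs (z + it t - it t') * Hs (z + it t)) * Hs z); first by ring.
  rewrite -k1; transitivity ((Fs (z + it t) * Hs z) * Hs (z + it t - it t')).
    by ring.
  by rewrite k2; ring.
have [[e [e0 Se]]|dense] :=
    pselect (exists e, 0 < e /\ forall x, S x -> 0 < x -> e <= x).
  have [a Sa] := discrete_subgroup e0 S0 SB Se.
  (* The periods produced by [Lambda] are 2 (l - l0), hence the step [a / 2]. *)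
  exfalso; apply: notAP; exists (arith_prog (a / 2) l0).
    by exists (a / 2), l0.
  move=> l Ll; have [k kE] := Sa _ (SL _ _ Ll0 Ll); exists k => //.
  by rewrite mulrAC -kE; field.
(* For fixed [z] the difference of the two sides is entire in [w] and vanishes at [it t] for
   arbitrarily small periods [t > 0]. *)
have const z w : Fs (z + w) * Hs z = Fs z * Hs (z + w).
  apply/eqP; rewrite -subr_eq0; apply/eqP; move: w.
  apply: (@entire_eq0 _ _ 0).
    by apply: entireB; apply: entireM; (exact: entire_cst ||
     by under eq_fun do rewrite addrC; exact: entire_shift).
  move=> e e0; apply: contrapT => noz; apply: dense; exists e; split=> // t St t0.
  rewrite leNgt; apply/negP => te; apply: noz; exists (it t); last first.
    by rewrite St subrr.
  rewrite subr0 /it ComplexField.Normc.normcM normc_real gtr0_norm//.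
  by rewrite /= expr0n expr1n add0r sqrtr1 mul1r t0.
have /existsNP[z0 /eqP Hz0] := Hsn0.
(* The constant value of [Fs / Hs], conjugated to return to [F] and [H]. *)
pose tau := conjc (Fs z0 / Hs z0).
have FtauH z : F z = tau * H z.
  have := const z0 (conjc z - z0); rewrite subrKC => E.
  have Fsz : Fs (conjc z) = Fs z0 / Hs z0 * Hs (conjc z).
    by rewrite mulrAC -E mulfK.
  move: Fsz; rewrite /Fs -/(Fs z0) conjcK => /(congr1 conjc).
  by rewrite conjcK rmorphM/= /Hs !conjcK.
exists tau => //.
(* [H] cannot vanish on a whole line; at a point of the line where it does not, equal moduli force
   |tau| = 1. *)
have [x Hx] : exists x : R, H (x%:C - it l0) <> 0.
  apply/not_existsP => h; apply: Hn0.
  apply: (@entire_eq0_line _ _ (- it l0)) => // x.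
  by apply: contrapT; exact: h.
have := FH x l0 Ll0; rewrite FtauH ComplexField.Normc.normcM.
rewrite -[RHS]mul1r => /mulIf; apply.
by rewrite normc_eq0; apply/eqP.
Qed.

End EntirePhaseRetrieval.

(** * Functions of rapid decay and their Laplace transforms *)

Section RapidDecay.
Variable R : realType.
Local Notation mu := (@lebesgue_measure R).
Implicit Types (f g : R -> R) (F G : R -> R[i]) (a : R).

Definition integrableR g := mu.-integrable [set: R] (EFin \o g).

Lemma integrableR_measurable g : integrableR g -> measurable_fun [set: R] g.
Proof. by move=> /measurable_int; move/measurable_EFinP. Qed.

Lemma integrableR_le f g : measurable_fun [set: R] f ->
  (forall t, `|f t| <= g t) -> integrableR g -> integrableR f.
Proof.
move=> mf fg; apply: le_integrable => //; first exact/measurable_EFinP.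
by move=> t _ /=; rewrite lee_fin (le_trans (fg t))// ler_norm.
Qed.

Lemma integrableRD f g : integrableR f -> integrableR g ->
  integrableR (fun t => f t + g t).
Proof. by move=> fi gi; have := integrableD measurableT fi gi. Qed.

Lemma integrableRB f g : integrableR f -> integrableR g ->
  integrableR (fun t => f t - g t).
Proof. by move=> fi gi; have := integrableB measurableT fi gi. Qed.

Lemma integrableRZ k f : integrableR f -> integrableR (fun t => k * f t).
Proof. by move=> fi; have := integrableZl measurableT k fi. Qed.

Lemma integrableR_norm f : integrableR f -> integrableR (fun t => `|f t|).
Proof. by move=> fi; have := integrable_abse fi. Qed.

(** Integrability against every exponential makes the Laplace transform converge on the whole plane,
    and it is stable under multiplication by functions of exponential growth. *)
Definition rapid f := forall a, integrableR (fun t => f t * expR (a * `|t|)).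

Lemma rapid_integrable f : rapid f -> integrableR f.
Proof.
move=> /(_ 0); rewrite /integrableR; congr (mu.-integrable _ (EFin \o _)).
by apply/funext => t; rewrite mul0r expR0 mulr1.
Qed.

Lemma rapid_measurable f : rapid f -> measurable_fun [set: R] f.
Proof. by move=> /rapid_integrable/integrableR_measurable. Qed.

Lemma measurable_expR_norm a : measurable_fun [set: R] (fun t : R => expR (a * `|t|)).
Proof.
by apply: measurableT_comp => //; apply: measurable_funM.
Qed.

Lemma rapidM f (phi : R -> R) (C b : R) : rapid f -> measurable_fun [set: R] phi ->
  (forall t, `|phi t| <= C * expR (b * `|t|)) -> rapid (fun t => f t * phi t).
Proof.
move=> fr mphi phib a.
apply: (@integrableR_le _ (fun t => C * `|f t * expR ((a + b) * `|t|)|)).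
- apply: measurable_funM; last exact: measurable_expR_norm.
  by apply: measurable_funM => //; exact: rapid_measurable.
- move=> t; rewrite !normrM !(ger0_norm (expR_ge0 _)) mulrDl expRD.
  rewrite [leRHS]mulrCA -mulrA ler_wpM2l// mulrC [leRHS]mulrCA.
  by rewrite ler_wpM2l ?expR_ge0.
- apply: integrableRZ; apply: integrableR_norm; exact: fr.
Qed.

Lemma rapidD f g : rapid f -> rapid g -> rapid (fun t => f t + g t).
Proof.
move=> fr gr a; under eq_fun do rewrite mulrDl.
by apply: integrableRD; [exact: fr | exact: gr].
Qed.

Lemma rapidB f g : rapid f -> rapid g -> rapid (fun t => f t - g t).
Proof.
move=> fr gr a; under eq_fun do rewrite mulrBl.
by apply: integrableRB; [exact: fr | exact: gr].
Qed.

Lemma rapid_norm f : rapid f -> rapid (fun t => `|f t|).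
Proof.
move=> fr a; have := integrableR_norm (fr a).
rewrite /integrableR; congr (mu.-integrable _ (EFin \o _)).
by apply/funext => t; rewrite normrM (ger0_norm (expR_ge0 _)).
Qed.

Definition integrableC F := integrableR (fun t => Re (F t)) /\ integrableR (fun t => Im (F t)).
Definition rapidC F := rapid (fun t => Re (F t)) /\ rapid (fun t => Im (F t)).

Lemma rapidC_integrable F : rapidC F -> integrableC F.
Proof. by move=> [? ?]; split; exact: rapid_integrable. Qed.

Lemma rapidCM F (phi : R -> R[i]) (C b : R) : rapidC F ->
  measurable_fun [set: R] (fun t => Re (phi t)) ->
  measurable_fun [set: R] (fun t => Im (phi t)) ->
  (forall t, nc (phi t) <= C * expR (b * `|t|)) -> rapidC (fun t => F t * phi t).
Proof.
move=> [Fr Fi] mr mi phib; split.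
  under eq_fun do rewrite Re_mul.
  by apply: rapidB; apply: (@rapidM _ _ C b) => // t; apply: le_trans (phib t);
    [exact: normr_Re_le | exact: normr_Im_le].
under eq_fun do rewrite Im_mul.
by apply: rapidD; apply: (@rapidM _ _ C b) => // t; apply: le_trans (phib t);
    [exact: normr_Im_le | exact: normr_Re_le].
Qed.

Lemma measurable_Re_cexp z : measurable_fun [set: R] (fun t : R => Re (cexp (t%:C * z))).
Proof.
rewrite (_ : (fun t => _) = (fun t : R => expR (t * Re z) * cos (t * Im z))).
  apply: measurable_funM; apply: measurableT_comp; (try by apply: measurable_funM).
    exact: measurable_expR.
  exact: continuous_measurable_fun (@continuous_cos R).
by apply/funext => t; rewrite Re_cexp Re_mul Im_mul/= !mul0r subr0 addr0.
Qed.

Lemma measurable_Im_cexp z : measurable_fun [set: R] (fun t : R => Im (cexp (t%:C * z))).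
Proof.
rewrite (_ : (fun t => _) = (fun t : R => expR (t * Re z) * sin (t * Im z))).
  apply: measurable_funM; apply: measurableT_comp; (try by apply: measurable_funM).
    exact: measurable_expR.
  exact: continuous_measurable_fun (@continuous_sin R).
by apply/funext => t; rewrite Im_cexp Re_mul Im_mul/= !mul0r subr0 addr0.
Qed.

Lemma rapidC_cexp F z : rapidC F -> rapidC (fun t => F t * cexp (t%:C * z)).
Proof.
move=> Fr; apply: (@rapidCM _ _ 1 (nc z)) => //.
- exact: measurable_Re_cexp.
- exact: measurable_Im_cexp.
move=> t; rewrite mul1r normc_cexp ler_expR mulrC.
by rewrite (le_trans (ler_norm _))// (le_trans (normr_Re_le _))//
  ComplexField.Normc.normcM normc_real.
Qed.

Lemma ler_exprn_fact_expR (x : R) n : 0 <= x -> x ^+ n / n`!%:R <= expR x.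
Proof.
move=> x0; case: n => [|n].
  by rewrite expr0 fact0 divr1 -expR0 ler_expR.
by apply: le_trans (expR_ge1Dxn n x0); rewrite lerDr.
Qed.

Lemma rapidC_monomial F n : rapidC F -> rapidC (fun t => F t * (t%:C ^+ n / n`!%:R)).
Proof.
have E t : (t%:C ^+ n / n`!%:R : R[i]) = (t ^+ n / n`!%:R)%:C.
  by rewrite rmorphM/= rmorphXn/= fmorphV/= rmorph_nat.
move=> Fr; apply: (@rapidCM _ _ 1 1) => //.
- under eq_fun do rewrite E.
  by apply: measurable_funM => //; exact: measurable_funX.
- by under eq_fun do rewrite E; exact: measurable_cst.
move=> t; rewrite E normc_real !mul1r normrM normrX normrV ?unitfE ?pnatr_eq0 -?lt0n ?fact_gt0//.
by rewrite normr_nat; exact: ler_exprn_fact_expR.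
Qed.

Lemma integrableCB F G : integrableC F -> integrableC G ->
  integrableC (fun t => F t - G t).
Proof.
move=> [Fr Fi] [Gr Gi]; split.
  by under eq_fun do rewrite Re_add Re_opp; exact: integrableRB.
by under eq_fun do rewrite Im_add Im_opp; exact: integrableRB.
Qed.

Lemma integrableCD F G : integrableC F -> integrableC G ->
  integrableC (fun t => F t + G t).
Proof.
move=> [Fr Fi] [Gr Gi]; split.
  by under eq_fun do rewrite Re_add; exact: integrableRD.
by under eq_fun do rewrite Im_add; exact: integrableRD.
Qed.

Lemma integrableCZ F k : integrableC F -> integrableC (fun t => F t * k).
Proof.
move=> [Fr Fi]; split.
  under eq_fun do rewrite Re_mul [Re (F _) * _]mulrC [Im (F _) * _]mulrC.
  by apply: integrableRB; exact: integrableRZ.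
under eq_fun do rewrite Im_mul [Re (F _) * _]mulrC [Im (F _) * _]mulrC.
by apply: integrableRD; exact: integrableRZ.
Qed.

Lemma integrableC0 : integrableC (fun=> 0).
Proof. by split; exact: integrable0. Qed.

Lemma integrableC_sum n (F : nat -> R -> R[i]) : (forall i, integrableC (F i)) ->
  integrableC (fun t => \sum_(i < n) F i t).
Proof.
move=> Fi; elim: n => [|n IH].
  by under eq_fun do rewrite big_ord0; exact: integrableC0.
by under eq_fun do rewrite big_ord_recr/=; exact: integrableCD.
Qed.

Lemma cintegralB F G : integrableC F -> integrableC G ->
  cintegral (fun t => F t - G t) = cintegral F - cintegral G.
Proof.
move=> [Fr Fi] [Gr Gi]; apply: complex_eqP; rewrite !(Re_add, Im_add, Re_opp, Im_opp)/=.
  by rewrite -RintegralB//; apply: eq_Rintegral => t _; rewrite Re_add Re_opp.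
by rewrite -RintegralB//; apply: eq_Rintegral => t _; rewrite Im_add Im_opp.
Qed.

Lemma cintegralD F G : integrableC F -> integrableC G ->
  cintegral (fun t => F t + G t) = cintegral F + cintegral G.
Proof.
move=> [Fr Fi] [Gr Gi]; apply: complex_eqP; rewrite !(Re_add, Im_add)/=.
  by rewrite -RintegralD//; apply: eq_Rintegral => t _; rewrite Re_add.
by rewrite -RintegralD//; apply: eq_Rintegral => t _; rewrite Im_add.
Qed.

Lemma cintegralZ F k : integrableC F ->
  cintegral (fun t => F t * k) = cintegral F * k.
Proof.
move=> [Fr Fi]; apply: complex_eqP; rewrite ?Re_mul ?Im_mul /=.
  rewrite -!RintegralZr// -RintegralB//; first by
    apply: eq_Rintegral => t _; rewrite Re_mul.
  - by have := integrableRZ (Re k) Fr; under eq_fun do rewrite mulrC.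
  - by have := integrableRZ (Im k) Fi; under eq_fun do rewrite mulrC.
rewrite -!RintegralZr// -RintegralD//; first by
  apply: eq_Rintegral => t _; rewrite Im_mul.
- by have := integrableRZ (Im k) Fr; under eq_fun do rewrite mulrC.
- by have := integrableRZ (Re k) Fi; under eq_fun do rewrite mulrC.
Qed.

Lemma cintegral_sum n (F : nat -> R -> R[i]) : (forall i, integrableC (F i)) ->
  cintegral (fun t => \sum_(i < n) F i t) = \sum_(i < n) cintegral (F i).
Proof.
move=> Fi; elim: n => [|n IH].
  rewrite big_ord0; under eq_fun do rewrite big_ord0.
  by apply: complex_eqP; rewrite /= Rintegral_cst// mul0r.
rewrite big_ord_recr/= -IH -cintegralD//; last exact: integrableC_sum.
by congr cintegral; apply/funext => t; rewrite big_ord_recr.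
Qed.

(** Real and imaginary parts are bounded separately, whence the factor 2. *)
Lemma normc_cintegral_le F g : integrableC F -> integrableR g ->
  (forall t, nc (F t) <= g t) ->
  nc (cintegral F) <= 2 * \int[mu]_t g t.
Proof.
move=> [Fr Fi] gi Fg; apply: le_trans (normc_le_ReIm _) _.
rewrite mulr2n mulrDl mul1r lerD//=.
  apply: le_trans (le_normr_Rintegral _ _) _ => //.
  apply: le_Rintegral => //; first exact: integrableR_norm.
  by move=> t _; apply: le_trans (normr_Re_le _) _.
apply: le_trans (le_normr_Rintegral _ _) _ => //.
apply: le_Rintegral => //; first exact: integrableR_norm.
by move=> t _; apply: le_trans (normr_Im_le _) _.
Qed.

(** The two-sided transform, with a plus sign in the exponent; on the imaginary axis it is a Fourier
    transform. *)
Definition laplace G (z : R[i]) : R[i] := cintegral (fun t => G t * cexp (t%:C * z)).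

(** The coefficients are the moments of [G] divided by factorials, and the remainder is the integral
    of [G] against [cexp_rem]. *)
Lemma power_series_laplace G : rapidC G -> power_series (laplace G).
Proof.
move=> Gr; pose c n : R[i] := cintegral (fun t => G t * (t%:C ^+ n / n`!%:R)).
exists c => r r0.
(* One [r] dominates the exponential of |t z|, the other absorbs (r |t|)^n / n!. *)
pose g t := (`|Re (G t)| + `|Im (G t)|) * expR ((r + r) * `|t|).
have gi : integrableR g.
  by have [/rapid_norm Gr1 /rapid_norm Gr2] := Gr; exact: rapidD.
exists (2 * \int[mu]_t g t) => n z zr.
have mono k : integrableC (fun t => G t * (t%:C ^+ k / k`!%:R) * z ^+ k).
  by apply/integrableCZ/rapidC_integrable/rapidC_monomial.
have -> : laplace G z - psum c n z = cintegral (fun t => G t * cexp_rem n (t%:C * z)).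
  rewrite /psum /c; under eq_bigr => k _.
    rewrite -cintegralZ; last exact/rapidC_integrable/rapidC_monomial.
    over.
  rewrite -(cintegral_sum n mono) /laplace -cintegralB.
  - congr cintegral; apply/funext => t; rewrite /cexp_rem mulrBr mulr_sumr.
    congr (_ - _); apply: eq_bigr => k _; rewrite exprMn; ring.
  - exact/rapidC_integrable/rapidC_cexp.
  - exact: (integrableC_sum n mono).
set q := nc z / r.
have /andP[q0 q1] : 0 <= q <= 1 by exact: ratio_bound.
rewrite [leRHS]mulrAC -mulrA -RintegralZl//.
apply: normc_cintegral_le => //.
- have : integrableC (fun t => G t * cexp (t%:C * z) -
      \sum_(k < n) G t * (t%:C ^+ k / k`!%:R) * z ^+ k).
    apply: integrableCB; last exact: (integrableC_sum n mono).
    exact/rapidC_integrable/rapidC_cexp.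
  congr integrableC; apply/funext => t; rewrite /cexp_rem mulrBr mulr_sumr.
  congr (_ - _); apply: eq_bigr => k _; rewrite exprMn; ring.
- exact: integrableRZ.
move=> t; rewrite ComplexField.Normc.normcM /g mulrCA ler_pM ?normc_ge0//.
  exact: normc_le_ReIm.
apply: le_trans (cexp_rem_le _ _) _.
rewrite ComplexField.Normc.normcM normc_real mulrDl expRD mulrA.
rewrite ler_pM ?expR_ge0//.
- by rewrite divr_ge0// exprn_ge0// mulr_ge0 ?normc_ge0.
- have -> : `|t| * nc z = q * (r * `|t|) by rewrite /q; field; rewrite gt_eqF.
  rewrite exprMn -mulrA ler_wpM2l ?exprn_ge0//.
  by apply: ler_exprn_fact_expR; rewrite mulr_ge0// ltW.
by rewrite ler_expR mulrC ler_wpM2r.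
Qed.

Lemma entire_laplace G : rapidC G -> entire (laplace G).
Proof.
move=> Gr w; rewrite (_ : (fun z => _) = laplace (fun t => G t * cexp (t%:C * w))).
  by apply: power_series_laplace; exact: rapidC_cexp.
apply/funext => z; congr cintegral; apply/funext => t.
by rewrite mulrDr cexpD mulrA.
Qed.

End RapidDecay.

(** * Approximation of a step function by trigonometric polynomials *)

Section StepApproximation.
Variable R : realType.
Implicit Types (x y u : R).

Lemma sin_le_id u : 0 <= u -> sin u <= u.
Proof.
move=> u0; rewrite -subr_ge0 -[leLHS](_ : 0 - sin 0 = 0); last by rewrite sin0 subrr.
by apply: (@le_derive_ge0 _ (fun t => t - sin t) (fun t => 1 - cos t)).
Qed.

Lemma cos_ge_quadratic u : 0 <= u -> 1 - u ^+ 2 / 2 <= cos u.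
Proof.
move=> u0; rewrite -subr_ge0.
have -> : 0 = (fun t : R => cos t - (1 - t ^+ 2 / 2)) 0.
  by rewrite /= cos0 expr0n/= mul0r subr0 subrr.
apply: (@le_derive_ge0 _ (fun t => cos t - (1 - t ^+ 2 / 2)) (fun t => t - sin t)) => //.
  move=> t; have H := is_derive_monomial 1 (2^-1 : R) t.
  apply: (is_derive_eq (is_deriveB (is_derive_cos t)
    (is_deriveB (is_derive_cst (1 : R) t 1) H))).
  by rewrite expr1; field.
by move=> t /andP[t0 _]; rewrite subr_ge0 sin_le_id.
Qed.

Lemma sin_ge_half u : 0 <= u <= 1 -> u / 2 <= sin u.
Proof.
move=> /andP[u0 u1]; rewrite -subr_ge0.
have -> : 0 = (fun t : R => sin t - t ^+ 1 * 2^-1) 0.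
  by rewrite /= sin0 expr1 mul0r subr0.
rewrite -[in u / 2](expr1 u).
apply: (@le_derive_ge0 _ (fun t => sin t - t ^+ 1 * 2^-1) (fun t => cos t - 2^-1)) => //.
  move=> t; have H := is_derive_monomial 0 (2^-1 : R) t.
  apply: (is_derive_eq (is_deriveB (is_derive_sin t) H)).
  by rewrite expr0 !mul1r.
move=> t /andP[t0 tu]; rewrite subr_ge0; apply: le_trans (cos_ge_quadratic t0).
have : t ^+ 2 <= 1 by rewrite expr_le1// (le_trans tu).
lra.
Qed.

Lemma bernoulli_le (q : R) n : 0 <= q <= 1 -> 1 - n%:R * q <= (1 - q) ^+ n.
Proof.
move=> /andP[q0 q1]; elim: n => [|n IH]; first by rewrite mul0r subr0 expr0.
rewrite exprS; apply: (@le_trans _ _ ((1 - q) * (1 - n%:R * q))).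
  rewrite -natr1; have : 0 <= n%:R * q * q :> R by rewrite !mulr_ge0.
  lra.
by rewrite ler_wpM2l// subr_ge0.
Qed.

Lemma bernoulli_ge (s : R) n : 0 <= s -> 1 + n%:R * s <= (1 + s) ^+ n.
Proof.
move=> s0; elim: n => [|n IH]; first by rewrite mul0r addr0 expr0.
rewrite exprS; apply: (@le_trans _ _ ((1 + s) * (1 + n%:R * s))).
  rewrite -natr1; have : 0 <= n%:R * s * s :> R by rewrite !mulr_ge0.
  lra.
by rewrite ler_wpM2l// addr_ge0.
Qed.

Lemma expRN_le_inv x : 0 < x -> expR (- x) <= x^-1.
Proof.
move=> x0; rewrite expRN lef_pV2 ?posrE ?expR_gt0//.
by apply: le_trans (expR_ge1Dx x); rewrite lerDr.
Qed.

Lemma expr_1B_le_expR (q : R) n : 0 <= q <= 1 -> (1 - q) ^+ n <= expR (- (n%:R * q)).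
Proof.
move=> /andP[q0 q1]; rewrite -mulrN expRM_natl lerXn2r ?nnegrE ?subr_ge0 ?expR_ge0//.
exact: expR_ge1Dx.
Qed.

(* At p = (1 + sin ((t - a) / k)) / 2, with N = k^2, the value (1 - p^N)^(2^N) is
   about exp (- (2 p)^N), and (2 p)^N behaves like exp (k (t - a)): the trigonometric
   polynomials step_poly k (sin ((t - a) / k)) tend boundedly to the indicator of t < a. *)
Definition step_poly (k : nat) : {poly R} :=
  (1 - (2^-1 *: (1 + 'X)) ^+ (k ^ 2)) ^+ (2 ^ (k ^ 2)).

Lemma horner_step_poly k x :
  (step_poly k).[x] = (1 - ((1 + x) / 2) ^+ (k ^ 2)) ^+ (2 ^ (k ^ 2)).
Proof.
by rewrite /step_poly horner_exp hornerD hornerN horner_exp hornerZ hornerD hornerX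
  hornerC [_^-1 * _]mulrC.
Qed.

Lemma step_poly_01 k x : -1 <= x <= 1 -> 0 <= (step_poly k).[x] <= 1.
Proof.
move=> /andP[x0 x1]; rewrite horner_step_poly.
have h : 0 <= (1 + x) / 2 <= 1 by apply/andP; split; lra.
have h2 : 0 <= ((1 + x) / 2) ^+ (k ^ 2) <= 1.
  by case/andP: h => ? ?; rewrite exprn_ge0// exprn_ile1.
case/andP: h2 => ? ?; rewrite exprn_ge0 ?subr_ge0// exprn_ile1 ?subr_ge0//.
by rewrite gerBl.
Qed.

(** With N = k^2 the value is at most exp (- (1 + s)^N), and (1 + s)^N >= N s by Bernoulli. *)
Lemma step_poly_right k (s : R) : 0 < s <= 1 -> (0 < k)%N ->
  (step_poly k).[s] <= ((k ^ 2)%:R * s)^-1.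
Proof.
move=> /andP[s0 s1] k0; rewrite horner_step_poly.
have h : 0 <= (1 + s) / 2 <= 1 by apply/andP; split; lra.
have N0 : (0 : R) < (k ^ 2)%:R * s by rewrite mulr_gt0// ltr0n expn_gt0 k0.
apply: le_trans (expr_1B_le_expR _ _) _.
  by case/andP: h => ? ?; rewrite exprn_ge0// exprn_ile1.
apply: (@le_trans _ _ (expR (- ((k ^ 2)%:R * s)))); last exact: expRN_le_inv.
rewrite ler_expR lerN2 [(2 ^ _)%:R]natrX -exprMn [2 * _]mulrC divfK ?pnatr_eq0//.
by apply: le_trans (bernoulli_ge _ (ltW s0)); rewrite lerDr.
Qed.

(** By Bernoulli the value is at least 1 - (1 - s)^N with N = k^2, and (1 - s)^N <= exp (- N s). *)
Lemma step_poly_left k (s : R) : 0 < s <= 1 -> (0 < k)%N ->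
  1 - ((k ^ 2)%:R * s)^-1 <= (step_poly k).[- s].
Proof.
move=> /andP[s0 s1] k0; rewrite horner_step_poly.
have h : 0 <= (1 + - s) / 2 <= 1 by apply/andP; split; lra.
have N0 : (0 : R) < (k ^ 2)%:R * s by rewrite mulr_gt0// ltr0n expn_gt0 k0.
apply: le_trans (bernoulli_le _ _); last first.
  by case/andP: h => ? ?; rewrite exprn_ge0// exprn_ile1.
rewrite lerD2l lerN2 [(2 ^ _)%:R]natrX -exprMn [2 * _]mulrC divfK ?pnatr_eq0//.
apply: le_trans (expr_1B_le_expR _ _) _; first by rewrite ltW.
exact: expRN_le_inv.
Qed.

(** For large k, s = sin (y / k) is at least y / (2 k), so k^2 s >= k y / 2 tends to infinity and
    both one-sided errors tend to 0. At [t = a] the values tend to exp (- 1) instead. *)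
Lemma step_poly_cvg (a t : R) : t != a ->
  (fun k => (step_poly k.+1).[sin ((t - a) / k.+1%:R)]) @ \oo -->
  ((t < a)%R%:R : R).
Proof.
move=> ta; set y := `|t - a|.
have y0 : 0 < y by rewrite normr_gt0 subr_eq0.
have small k : y <= k.+1%:R -> y / k.+1%:R / 2 <= sin (y / k.+1%:R).
  move=> yk; apply: sin_ge_half; apply/andP; split; first by rewrite divr_ge0 ?ltW.
  by rewrite ler_pdivrMr ?ltr0n// mul1r.
apply/cvgrPdist_le => e e0; near=> k.
(* The first threshold brings the angle into [0, 1], where [sin_ge_half] applies; the second makes
   the error at most [e]. *)
have yk : y <= k.+1%:R.
  by rewrite (@le_trans _ _ k%:R) ?ler_nat//; near: k; exact: nbhs_infty_ger.
have ek : 2 / (y * e) <= k.+1%:R.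
  by rewrite (@le_trans _ _ k%:R) ?ler_nat//; near: k; exact: nbhs_infty_ger.
set s := sin (y / k.+1%:R).
have ss : y / k.+1%:R / 2 <= s by exact: small.
have s0 : 0 < s by apply: lt_le_trans ss; rewrite !divr_gt0.
have s1 : 0 < s <= 1 by rewrite s0 sin_le1.
have N0 : 0 < (k.+1 ^ 2)%:R * s by rewrite mulr_gt0// ltr0n expn_gt0.
have bound : ((k.+1 ^ 2)%:R * s)^-1 <= e.
  rewrite -[leRHS]invrK lef_pV2 ?posrE ?invr_gt0//.
  apply: (@le_trans _ _ ((k.+1 ^ 2)%:R * (y / k.+1%:R / 2))); last by rewrite ler_wpM2l.
  have -> : (k.+1 ^ 2)%:R * (y / k.+1%:R / 2) = k.+1%:R * (y / 2) :> R.
    by rewrite natrX; field; rewrite nat1r pnatr_eq0.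
  rewrite -ler_pdivrMr ?divr_gt0//; apply: le_trans ek.
  by rewrite le_eqVlt; apply/orP; left; apply/eqP; field; rewrite !gt_eqF.
have [tlta|ge] := ltP t a.
  have yE : (t - a) / k.+1%:R = - (y / k.+1%:R).
    by rewrite /y ltr0_norm ?subr_lt0// mulNr opprK.
  rewrite yE sinN -/s/=.
  have /andP[_ le1] : 0 <= (step_poly k.+1).[- s] <= 1.
    by apply: step_poly_01; rewrite lerN2 sin_le1/= lerNl (le_trans _ (ltW s0))// lerN10.
  rewrite ger0_norm ?subr_ge0//; apply: le_trans bound.
  by rewrite lerBlDr addrC -lerBlDr; exact: step_poly_left.
have yE : (t - a) / k.+1%:R = y / k.+1%:R by rewrite /y ger0_norm ?subr_ge0.
rewrite yE -/s/= sub0r normrN.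
have /andP[ge0 _] : 0 <= (step_poly k.+1).[s] <= 1.
  by apply: step_poly_01; rewrite sin_le1 (le_trans _ (ltW s0))// lerN10.
by rewrite ger0_norm//; apply: le_trans bound; exact: step_poly_right.
Unshelve. all: by end_near. Qed.

End StepApproximation.

(** * Uniqueness of Fourier transforms of integrable functions *)

Section FourierUniqueness.
Variable R : realType.
Local Notation mu := (@lebesgue_measure R).
Variable g : R -> R.
Hypothesis gi : integrableR g.
Hypothesis g_cos : forall s c, \int[mu]_t (g t * cos (t * s + c)) = 0.

(** Bounded multipliers that keep [g] orthogonal to all cosines. Quantifying over every frequency
    and phase makes the class stable under multiplication by cosines. *)
Definition annihilated (phi : R -> R) : Prop :=
  [/\ measurable_fun [set: R] phi, exists M, forall t, `|phi t| <= M &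
      forall s c, \int[mu]_t (g t * phi t * cos (t * s + c)) = 0].

Lemma measurable_cos_affine s c : measurable_fun [set: R] (fun t : R => cos (t * s + c)).
Proof.
apply: measurableT_comp; first exact: continuous_measurable_fun (@continuous_cos R).
by apply: measurable_funD => //; exact: measurable_funM.
Qed.

Lemma normr_cos_le1 (x : R) : `|cos x| <= 1.
Proof. by rewrite ler_norml cos_geN1 cos_le1. Qed.

Lemma integrableRM_bounded (phi : R -> R) M : measurable_fun [set: R] phi ->
  (forall t, `|phi t| <= M) -> integrableR (fun t => g t * phi t).
Proof.
move=> mphi phiM; apply: (@integrableR_le _ _ (fun t => M * `|g t|)).
- by apply: measurable_funM => //; exact: integrableR_measurable gi.
- by move=> t; rewrite normrM mulrC ler_wpM2r.
- by apply: integrableRZ; exact: integrableR_norm.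
Qed.

Lemma annihilated_integrable phi s c : annihilated phi ->
  integrableR (fun t => g t * phi t * cos (t * s + c)).
Proof.
move=> [mphi [M phiM] _].
under eq_fun do rewrite -mulrA; apply: (@integrableRM_bounded _ M).
  by apply: measurable_funM => //; exact: measurable_cos_affine.
move=> t; rewrite normrM; apply: le_trans (phiM t); rewrite ler_piMr//.
exact: normr_cos_le1.
Qed.

Lemma annihilated_cst k : annihilated (fun=> k).
Proof.
split; [exact: measurable_cst | by exists `|k| | move=> s c].
under eq_Rintegral do rewrite mulrAC.
rewrite RintegralZr ?g_cos ?mul0r//.
apply: (@integrableRM_bounded _ 1); first exact: measurable_cos_affine.
by move=> t; exact: normr_cos_le1.
Qed.

Lemma annihilatedD phi psi : annihilated phi -> annihilated psi ->
  annihilated (fun t => phi t + psi t).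
Proof.
move=> aphi apsi; have [m1 [M1 b1] z1] := aphi; have [m2 [M2 b2] z2] := apsi.
split; first exact: measurable_funD.
  by exists (M1 + M2) => t; apply: le_trans (ler_normD _ _) _; rewrite lerD.
move=> s c; under eq_Rintegral do rewrite mulrDr mulrDl.
by rewrite RintegralD ?z1 ?z2 ?addr0//; exact: annihilated_integrable.
Qed.

(** The product-to-sum formula replaces two cosines by cosines of the sum and the difference of
    their arguments. *)
Lemma annihilatedM_cos phi s c : annihilated phi ->
  annihilated (fun t => phi t * cos (t * s + c)).
Proof.
move=> aphi; have [m1 [M1 b1] z1] := aphi; split.
- by apply: measurable_funM => //; exact: measurable_cos_affine.
- exists M1 => t; rewrite normrM; apply: le_trans (b1 t); rewrite ler_piMr//.
  exact: normr_cos_le1.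
move=> s' c'.
have E t : g t * (phi t * cos (t * s + c)) * cos (t * s' + c') =
   2^-1 * (g t * phi t * cos (t * (s + s') + (c + c')) +
           g t * phi t * cos (t * (s - s') + (c - c'))).
  have -> : t * (s + s') + (c + c') = (t * s + c) + (t * s' + c') by ring.
  have -> : t * (s - s') + (c - c') = (t * s + c) - (t * s' + c') by ring.
  by move: (t * s + c) (t * s' + c') => u v; rewrite cosB cosD; field.
under eq_Rintegral do rewrite E.
rewrite RintegralZl//; last by apply: integrableRD; exact: annihilated_integrable.
by rewrite RintegralD ?z1 ?addr0 ?mulr0//; exact: annihilated_integrable.
Qed.

Lemma annihilated_horner_sin (p : {poly R}) s c :
  annihilated (fun t => p.[sin (t * s + c)]).
Proof.
have sinE t : sin (t * s + c) = cos (t * s + (c - pi / 2)).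
  by rewrite addrA cosB cos_pihalf sin_pihalf mulr0 mulr1 add0r.
elim/poly_ind: p => [|p k IH].
  by under eq_fun do rewrite horner0; exact: annihilated_cst.
under eq_fun do rewrite hornerMXaddC [X in _ * X]sinE.
by apply: annihilatedD; [exact: annihilatedM_cos | exact: annihilated_cst].
Qed.

(** The trigonometric polynomials tending to the indicator of t < a integrate to 0 against [g];
    dominated convergence with majorant |g| passes to the limit. *)
Lemma cumulative_integral_eq0 (a : R) : \int[mu]_(t in `]-oo, a]) g t = 0.
Proof.
rewrite Rintegral_mkcond.
pose phi k (t : R) := (step_poly R k.+1).[sin (t * k.+1%:R^-1 + - a * k.+1%:R^-1)].
have phi0 k : \int[mu]_t (g t * phi k t) = 0.
  have [_ _ /(_ 0 0)] := annihilated_horner_sin (step_poly R k.+1) k.+1%:R^-1 (- a * k.+1%:R^-1).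
  by under eq_Rintegral do rewrite mulr0 addr0 cos0 mulr1.
have phi1 k t : 0 <= phi k t <= 1.
  by apply: step_poly_01; rewrite sin_geN1 sin_le1.
have mg := integrableR_measurable gi.
have [] := @dominated_convergence _ _ _ mu setT measurableT
  (fun k t => (g t * phi k t)%:E) (EFin \o (g \_ `]-oo, a])) (EFin \o (fun t => `|g t|)).
- move=> k; apply/measurable_EFinP; apply: measurable_funM => //.
  by have [] := annihilated_horner_sin (step_poly R k.+1) k.+1%:R^-1 (- a * k.+1%:R^-1).
- apply/measurable_EFinP; apply/(measurable_restrictT _ _).1 => //.
  exact: measurable_funTS.
(* Convergence is claimed off the null set consisting of [a]. *)
- exists [set a]; split => //; first exact: lebesgue_measure_set1.
  move=> t /= h; apply: contrapT => ta; apply: h => _.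
  apply: cvg_EFin; first by apply: nearW.
  rewrite [X in _ --> X](_ : _ = g t * (t < a)%R%:R); last first.
    rewrite patchE mem_setE/= in_itv/=.
    move/eqP: ta; rewrite neq_lt => /orP[lt_ta|lt_at].
      by rewrite ltW// lt_ta mulr1.
    by rewrite leNgt lt_at/= ltNge ltW// mulr0.
  apply: cvgMr.
  rewrite /phi; under eq_fun do rewrite -mulrDl.
  by apply: step_poly_cvg; apply/eqP.
- exact: integrableR_norm.
- apply: aeW => t k _ /=; rewrite lee_fin normrM ler_piMr//.
  by case/andP: (phi1 k t) => ? ?; rewrite ger0_norm.
move=> _ _; rewrite /Rintegral.
rewrite (_ : [sequence _]_n = cst 0%E); last first.
  apply/funext => k /=; rewrite -[LHS]fineK.
    by have := phi0 k; rewrite /Rintegral => ->.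
  apply: integrable_fin_num => //; apply: (@integrableRM_bounded _ 1).
    by have [] := annihilated_horner_sin (step_poly R k.+1) k.+1%:R^-1 (- a * k.+1%:R^-1).
  by move=> t; case/andP: (phi1 k t) => ? ?; rewrite ger0_norm.
by move=> /(cvg_unique _ (@cvg_cst _ _ _ _ _)) /= <-.
Qed.

(** By Lebesgue differentiation [g] is almost everywhere the derivative of its cumulative integral,
    which is constantly 0. *)
Lemma ae_eq0_of_cos : {ae mu, forall t, g t = 0}.
Proof.
have gl : locally_integrable [set: R] g.
  by have := integrable_locally measurableT gi; rewrite patch_setT.
have gy y : mu.-integrable `]-oo, y] (EFin \o g).
  by apply: integrableS gi => //.
have := FTC1Ny gy gl; apply: filterS; first exact: (ae_filter_ringOfSetsType mu).
move=> t [_].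
have -> : (fun x => \int[mu]_(t in [set` `]-oo, x]]) g t) = cst 0.
  by apply/funext => x; exact: cumulative_integral_eq0.
by rewrite derive1_cst.
Qed.

End FourierUniqueness.

(** * Injectivity of the Laplace transform *)

Section LaplaceUniqueness.
Variable R : realType.
Local Notation mu := (@lebesgue_measure R).

Lemma cintegral_ae_eq (F G : R -> R[i]) : integrableC F -> integrableC G ->
  {ae mu, forall t, F t = G t} -> cintegral F = cintegral G.
Proof.
move=> [Fr Fi] [Gr Gi] FG; apply: complex_eqP; rewrite /= /Rintegral; congr fine.
  apply: ae_eq_integral; [exact: measurableT|exact: measurable_int Fr|exact: measurable_int Gr|].
  by move: FG; apply: filterS; [exact: (ae_filter_ringOfSetsType mu) | move=> t /= ->].
apply: ae_eq_integral; [exact: measurableT|exact: measurable_int Fi|exact: measurable_int Gi|].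
by move: FG; apply: filterS; [exact: (ae_filter_ringOfSetsType mu) | move=> t /= ->].
Qed.

(** On the imaginary axis the transform mixes the cosine and sine integrals of the real and
    imaginary parts of [G]. Comparing [s] with [- s] separates the even ones from the odd ones, so
    each vanishes. *)
Lemma laplace_inj (G : R -> R[i]) : rapidC G -> (forall z, laplace G z = 0) ->
  {ae mu, forall t, G t = 0}.
Proof.
move=> [Gr Gi] G0.
have trig (g : R -> R) : rapid g -> forall s : R,
   integrableR (fun t => g t * cos (t * s)) /\ integrableR (fun t => g t * sin (t * s)).
  move=> gr s; split; apply: rapid_integrable; apply: (@rapidM _ _ _ 1 0) => //.
  - by have := measurable_cos_affine s 0; under eq_fun do rewrite addr0.
  - by move=> t; rewrite mul0r expR0 mulr1; exact: normr_cos_le1.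
  - apply: measurableT_comp; first exact: continuous_measurable_fun (@continuous_sin R).
    exact: measurable_funM.
  - by move=> t; rewrite mul0r expR0 mulr1 ler_norml sin_geN1 sin_le1.
pose A s := \int[mu]_t (Re (G t) * cos (t * s)); pose B s := \int[mu]_t (Re (G t) * sin (t * s)).
pose C s := \int[mu]_t (Im (G t) * cos (t * s)); pose D s := \int[mu]_t (Im (G t) * sin (t * s)).
have E t (s : R) : cexp (t%:C * ('i%C * s%:C)) = cos (t * s) +i* sin (t * s).
  rewrite (_ : t%:C * _ = 'i%C * (t * s)%:C); first exact: cexp_imag.
  by rewrite rmorphM/=; ring.
have AD s : A s - D s = 0.
  rewrite /A /D -RintegralB//; try exact: (trig _ _ _).1; try exact: (trig _ _ _).2.
  have /(congr1 (@complex.Re R))/= := G0 ('i%C * s%:C); rewrite /laplace /cintegral/= => <-.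
  by apply: eq_Rintegral => t _; rewrite E Re_mul.
have BC s : B s + C s = 0.
  rewrite /B /C -RintegralD//; try exact: (trig _ _ _).1; try exact: (trig _ _ _).2.
  have /(congr1 (@complex.Im R))/= := G0 ('i%C * s%:C); rewrite /laplace /cintegral/= => <-.
  by apply: eq_Rintegral => t _; rewrite E Im_mul addrC.
have AN s : A (- s) = A s by apply: eq_Rintegral => t _; rewrite mulrN cosN.
have CN s : C (- s) = C s by apply: eq_Rintegral => t _; rewrite mulrN cosN.
have DN s : D (- s) = - D s.
  rewrite /D -[RHS]mulN1r -RintegralZl//; last exact: (trig _ _ _).2.
  by apply: eq_Rintegral => t _; rewrite mulrN sinN; ring.
have BN s : B (- s) = - B s.
  rewrite /B -[RHS]mulN1r -RintegralZl//; last exact: (trig _ _ _).2.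
  by apply: eq_Rintegral => t _; rewrite mulrN sinN; ring.
have A0 s : A s = 0 by have := AD s; have := AD (- s); rewrite AN DN; lra.
have D0 s : D s = 0 by have := AD s; rewrite A0; lra.
have C0 s : C s = 0 by have := BC s; have := BC (- s); rewrite CN BN; lra.
have B0 s : B s = 0 by have := BC s; rewrite C0; lra.
have shift (g : R -> R) : rapid g ->
    (forall s, \int[mu]_t (g t * cos (t * s)) = 0) ->
    (forall s, \int[mu]_t (g t * sin (t * s)) = 0) ->
    {ae mu, forall t, g t = 0}.
  move=> gr gc gs; apply: ae_eq0_of_cos; first exact: rapid_integrable.
  move=> s c; have [ic is_] := trig _ gr s.
  under eq_Rintegral do rewrite cosD mulrBr !mulrA.
  rewrite RintegralB//.
  - by rewrite !RintegralZr// gc gs !mul0r subrr.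
  - by have := integrableRZ (cos c) ic; under eq_fun do rewrite mulrC.
  - by have := integrableRZ (sin c) is_; under eq_fun do rewrite mulrC.
have re0 := shift _ Gr A0 B0; have im0 := shift _ Gi C0 D0.
move: re0 im0; apply: filterS2; first exact: (ae_filter_ringOfSetsType mu).
by move=> t r0 i0; exact: complex_eqP.
Qed.

End LaplaceUniqueness.

(** * Gaussian integrals and windowed L2 signals *)

Section Gaussian.
Variable R : realType.
Local Notation mu := (@lebesgue_measure R).

Lemma normal_fun_gaussian (c m t : R) : 0 < c ->
  normal_fun m (Num.sqrt (2 * c)^-1) t = expR (- (c * (t - m) ^+ 2)).
Proof.
move=> c0; rewrite /normal_fun sqr_sqrtr ?invr_ge0 ?mulr_ge0 ?ltW//.
by congr expR; rewrite -mulr_natr; field; rewrite gt_eqF.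
Qed.

Lemma integrable_gaussian (c m : R) : 0 < c ->
  integrableR (fun t => expR (- (c * (t - m) ^+ 2))).
Proof.
move=> c0; set s := Num.sqrt (2 * c)^-1.
have s0 : s != 0 by rewrite gt_eqF// sqrtr_gt0 invr_gt0 mulr_gt0.
have := integrableRZ (normal_peak s)^-1 (integrable_normal_pdf m s).
congr (mu.-integrable _ (EFin \o _)); apply/funext => t.
rewrite /normal_pdf (negbTE s0) mulKf ?gt_eqF ?normal_peak_gt0//.
exact: normal_fun_gaussian.
Qed.

(** The Gaussian is a multiple of the normal density of variance 1 / (2 c), with a factor
    independent of the mean [m]. *)
Lemma integral_gaussian (c : R) : 0 < c ->
  exists2 J, 0 < J & forall m, \int[mu]_t expR (- (c * (t - m) ^+ 2)) = J.
Proof.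
move=> c0; set s := Num.sqrt (2 * c)^-1.
have s0 : s != 0 by rewrite gt_eqF// sqrtr_gt0 invr_gt0 mulr_gt0.
exists (normal_peak s)^-1; first by rewrite invr_gt0 normal_peak_gt0.
move=> m.
have -> : (fun t => expR (- (c * (t - m) ^+ 2))) =
    (fun t => (normal_peak s)^-1 * normal_pdf m s t).
  apply/funext => t; rewrite /normal_pdf (negbTE s0) mulKf ?gt_eqF ?normal_peak_gt0//.
  by rewrite normal_fun_gaussian.
rewrite RintegralZl//; last exact: integrable_normal_pdf.
by rewrite /Rintegral integral_normal_pdf mulr1.
Qed.

Lemma rapid_gaussian (c : R) : 0 < c -> rapid (fun t => expR (- (c * t ^+ 2))).
Proof.
move=> c0 a.
have c20 : 0 < c / 2 by rewrite divr_gt0.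
have mg : measurable_fun [set: R] (fun t : R => expR (- (c * t ^+ 2))).
  apply: measurableT_comp => //; apply: measurableT_comp => //.
  by apply: measurable_funM => //; exact: measurable_funX.
(* Completing the square: a |t| <= c t^2 / 2 + a^2 / (2 c). *)
apply: (@integrableR_le _ _ (fun t => expR (a ^+ 2 / (2 * c)) * expR (- (c / 2 * (t - 0) ^+ 2)))).
- by apply: measurable_funM => //; exact: measurable_expR_norm.
- move=> t; rewrite ger0_norm ?mulr_ge0 ?expR_ge0// -!expRD ler_expR subr0.
  rewrite -subr_ge0 (_ : _ - _ = (c * `|t| - a) ^+ 2 / (2 * c)).
    by rewrite divr_ge0 ?sqr_ge0// mulr_ge0 ?ltW.
  have -> : t ^+ 2 = `|t| ^+ 2 by rewrite real_normK ?num_real.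
  by field; rewrite gt_eqF.
- by apply: integrableRZ; exact: integrable_gaussian.
Qed.

(** With [v] the window times the exponential, |u v| <= u^2 + v^2, and v^2 is again a Gaussian times
    an exponential. *)
Lemma rapid_gauss_window_mul (u : R -> R) : measurable_fun [set: R] u ->
  integrableR (fun t => u t ^+ 2) -> rapid (fun t => u t * gauss_window t).
Proof.
move=> mu_ u2 a.
have g2 : integrableR (fun t : R => expR (- (2 * pi * t ^+ 2)) * expR (2 * a * `|t|)).
  by apply: rapid_gaussian; rewrite mulr_gt0 ?pi_gt0.
have mg : measurable_fun [set: R] (@gauss_window R).
  have /rapid_measurable := rapid_gaussian (@pi_gt0 R).
  exact.
apply: integrableR_le (integrableRD u2 g2).
  apply: measurable_funM; last exact: measurable_expR_norm.
  exact: measurable_funM.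
move=> t; rewrite -mulrA normrM; set v := gauss_window t * _.
have -> : expR (- (2 * pi * t ^+ 2)) * expR (2 * a * `|t|) = v ^+ 2.
  by rewrite /v /gauss_window -!expRD -expRM_natl; congr expR; ring.
rewrite -(real_normK (num_real (u t))) -(real_normK (num_real v)).
have := sqr_ge0 (`|u t| - `|v|); have := normr_ge0 (u t); have := normr_ge0 v.
nra.
Qed.

Lemma rapidC_L2 (f : R -> R[i]) : L2 f -> rapidC (fun t => f t * (gauss_window t)%:C).
Proof.
move=> [mr mi fin].
have i2 : integrableR (fun t => nc (f t) ^+ 2).
  apply/integrableP; split.
    apply/measurable_EFinP; under eq_fun do rewrite sqr_normcE.
    by apply: measurable_funD; exact: measurable_funX.
  apply: le_lt_trans fin; rewrite le_eqVlt; apply/orP; left; apply/eqP.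
  by apply: eq_integral => t _ /=; rewrite ger0_norm ?sqr_ge0.
split.
  under eq_fun do rewrite Re_mul/= mulr0 subr0.
  apply: rapid_gauss_window_mul => //.
  apply: integrableR_le i2; first exact: measurable_funX.
  by move=> t; rewrite ger0_norm ?sqr_ge0// sqr_normcE lerDl sqr_ge0.
under eq_fun do rewrite Im_mul/= mulr0 add0r.
apply: rapid_gauss_window_mul => //.
apply: integrableR_le i2; first exact: measurable_funX.
by move=> t; rewrite ger0_norm ?sqr_ge0// sqr_normcE lerDr sqr_ge0.
Qed.

End Gaussian.

(** * The Laplace transform of a Gaussian *)

Section GaussianLaplace.
Variable R : realType.

Lemma entire_cexp (a : R[i]) : entire (fun z => cexp (z * a)).
Proof.
have ps : power_series (@cexp R).
  exists (fun k => (k`!%:R)^-1) => r r0; exists (expR (r + r)) => n z zr.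
  have -> : cexp z - psum (fun k => (k`!%:R)^-1) n z = cexp_rem n z.
    by congr (_ - _); apply: eq_bigr => k _; rewrite mulrC.
  apply: le_trans (cexp_rem_le _ _) _.
  have -> : nc z ^+ n / n`!%:R = (nc z / r) ^+ n * (r ^+ n / n`!%:R).
    by rewrite mulrA -exprMn divfK// gt_eqF.
  have q0 : 0 <= (nc z / r) ^+ n by rewrite exprn_ge0// divr_ge0 ?normc_ge0// ltW.
  rewrite expRD [leRHS]mulrC -mulrA ler_wpM2l// ler_pM ?expR_ge0//.
  - by rewrite divr_ge0// exprn_ge0// ltW.
  - by apply: ler_exprn_fact_expR; exact: ltW.
  - by rewrite ler_expR.
have e1 : entire (@cexp R).
  move=> w; under eq_fun do rewrite cexpD.
  by apply: power_seriesM => //; exact: power_series_cst.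
by under eq_fun do rewrite mulrC; exact: entire_scale.
Qed.

(** The square of [gauss_window]: the function to be transformed when the signal is the window
    itself. *)
Definition gaussian2 (t : R) : R[i] := (expR (- (2 * pi * t ^+ 2)))%:C.

Lemma rapidC_gaussian2 : rapidC gaussian2.
Proof.
split => /=; first by apply: rapid_gaussian; rewrite mulr_gt0 ?pi_gt0.
move=> a; under eq_fun do rewrite mul0r; exact: integrable0.
Qed.

Let Psi := laplace gaussian2.

(** Completing the square moves the center to x / (4 pi) and leaves the factor exp (x^2 / (8
    pi)). *)
Lemma laplace_gaussian2_real : exists2 J : R, 0 < J &
  forall x : R, Psi x%:C = (J * expR (x ^+ 2 / (8 * pi)))%:C.
Proof.
have c0 : 0 < 2 * pi :> R by rewrite mulr_gt0 ?pi_gt0.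
have [J J0 JE] := integral_gaussian c0; exists J => // x.
have E t : gaussian2 t * cexp (t%:C * x%:C) =
   (expR (- (2 * pi * (t - x / (4 * pi)) ^+ 2)) * expR (x ^+ 2 / (8 * pi)))%:C.
  rewrite -rmorphM/= cexp_real -rmorphM/= -!expRD; congr (expR _)%:C.
  by have := @pi_gt0 R; move: (@pi R) => p p0; field; rewrite gt_eqF.
rewrite /Psi /laplace (funext E); apply: complex_eqP => /=.
  by rewrite RintegralZr// ?JE//; exact: integrable_gaussian.
by rewrite Rintegral_cst// mul0r.
Qed.

(** The addition law of Psi (z) = Psi (0) exp (z^2 / (8 pi)). It is checked for real arguments and
    extended by the identity theorem, one variable at a time. *)
Lemma laplace_gaussian2D z v :
  Psi (z + v) * Psi 0 = Psi z * Psi v * cexp (z * v / (4 * pi)%:C).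
Proof.
have Pe : entire Psi by apply: entire_laplace; exact: rapidC_gaussian2.
have [J J0 JE] := laplace_gaussian2_real.
have real (x y : R) : Psi (x%:C + y%:C) * Psi 0 =
    Psi x%:C * Psi y%:C * cexp (x%:C * y%:C / (4 * pi)%:C).
  have -> : x%:C * y%:C / (4 * pi)%:C = (x * y / (4 * pi))%:C.
    by rewrite [RHS]rmorphM/= fmorphV; congr (_ / _); rewrite rmorphM.
  rewrite -[0]/(0%:C) -rmorphD/= !JE cexp_real -!rmorphM/= expr0n/= mul0r expR0 mulr1.
  congr (_%:C).
  have -> : expR ((x + y) ^+ 2 / (8 * pi)) =
      expR (x ^+ 2 / (8 * pi)) * (expR (y ^+ 2 / (8 * pi)) * expR (x * y / (4 * pi))).
    rewrite -!expRD; congr expR.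
    by have := @pi_gt0 R; move: (@pi R) => p p0; field; rewrite gt_eqF.
  by ring.
have shiftl (a : R[i]) : entire (fun z => Psi (z + a)) by exact: entire_shift.
have mix (x : R) w : Psi (w + x%:C) * Psi 0 = Psi w * Psi x%:C * cexp (w * x%:C / (4 * pi)%:C).
  apply/eqP; rewrite -subr_eq0; apply/eqP; move: w.
  apply: (@entire_eq0_line _ _ 0).
    apply: entireB; apply: entireM => //; try exact: entire_cst.
      by apply: entireM => //; exact: entire_cst.
    by under eq_fun do rewrite -mulrA; exact: entire_cexp.
  by move=> y; rewrite addr0 real subrr.
apply/eqP; rewrite -subr_eq0; apply/eqP; move: v.
apply: (@entire_eq0_line _ _ 0).
  apply: entireB; apply: entireM => //; try exact: entire_cst.
  - by under eq_fun do rewrite addrC; exact: entire_shift.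
  - by apply: entireM => //; exact: entire_cst.
  - by under eq_fun do rewrite mulrAC mulrC; exact: entire_cexp.
by move=> x; rewrite addr0 mix subrr.
Qed.

(** By the addition law with [v = - z], a zero of [Psi] would make [Psi 0] vanish. *)
Lemma laplace_gaussian2_neq0 z : Psi z != 0.
Proof.
have [J J0 JE] := laplace_gaussian2_real.
have P0 : Psi 0 != 0.
  rewrite -[0]/(0%:C) JE expr0n/= mul0r expR0 mulr1.
  by rewrite -normc_gt0 normc_real normr_gt0 gt_eqF.
apply/eqP => Pz; have := laplace_gaussian2D z (- z).
rewrite Pz !mul0r subrr => /eqP; rewrite mulf_eq0 orbb => /eqP P00.
by rewrite P00 eqxx in P0.
Qed.

End GaussianLaplace.

(** * From the Gabor transform to the Laplace transform *)

Section Gabor.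
Variable R : realType.
Local Notation mu := (@lebesgue_measure R).

(** If (p, q) is the rotated point, this is 2 pi (p - i q): rotation multiplies p + i q by exp (i
    theta), and conjugation reverses the angle. *)
Definition laplace_arg (theta : R) (x l : R) : R[i] :=
  (2 * pi)%:C * expi (- theta) * (x%:C - 'i%C * l%:C).

(** Expanding the square in the shifted window leaves the centered window, an exponential in t that
    joins the modulation, and a positive factor independent of [f]. *)
Lemma gabor_laplace (f : R -> R[i]) (theta x l : R) : L2 f ->
  gabor f (rotation theta (x, l)) =
  laplace (fun t => f t * (gauss_window t)%:C) (laplace_arg theta x l) *
  (expR (- (pi * (rotation theta (x, l)).1 ^+ 2)))%:C.
Proof.
move=> f2; set z := rotation theta (x, l).
have zE : laplace_arg theta x l = (2 * pi * z.1) -i* (2 * pi * z.2).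
  rewrite /laplace_arg /z/= /expi cosN sinN.
  by apply: complex_eqP; rewrite !(Re_mul, Im_mul, Re_add, Im_add, Re_opp, Im_opp)/=; ring.
rewrite /gabor /laplace -cintegralZ; last first.
  by apply/rapidC_integrable/rapidC_cexp/rapidC_L2.
congr cintegral; apply/funext => t; rewrite zE; move: z {zE} => z.
have -> : cexp (t%:C * ((2 * pi * z.1) -i* (2 * pi * z.2))) =
   (expR (2 * pi * t * z.1))%:C * expi (- (2 * pi * z.2 * t)).
  have -> : t%:C * ((2 * pi * z.1) -i* (2 * pi * z.2)) =
    (2 * pi * t * z.1)%:C + 'i%C * (- (2 * pi * z.2 * t))%:C.
    by apply: complex_eqP; rewrite !(Re_mul, Im_mul, Re_add, Im_add, Re_opp, Im_opp)/=; ring.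
  by rewrite cexpD cexp_real cexp_imag.
have -> : gauss_window (t - z.1) =
    gauss_window t * expR (2 * pi * t * z.1) * expR (- (pi * z.1 ^+ 2)).
  by rewrite /gauss_window -!expRD; congr expR; ring.
by rewrite !rmorphM/=; ring.
Qed.

Lemma normr_gabor_eq (f h : R -> R[i]) (theta x l : R) : L2 f -> L2 h ->
  let T u := laplace (fun t => u t * (gauss_window t)%:C) (laplace_arg theta x l) in
  `|gabor f (rotation theta (x, l))| = `|gabor h (rotation theta (x, l))| <->
  nc (T f) = nc (T h).
Proof.
move=> f2 h2 T; rewrite !gabor_laplace// !normrM; split; last first.
  by move=> Tfh; rewrite !normr_normc Tfh.
move/mulIf => Tfh; apply: complexI; apply: Tfh.
by rewrite normr_eq0 -normc_eq0 normc_real normr_eq0 gt_eqF ?expR_gt0.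
Qed.

Lemma gabor_uniqueness (theta : R) (Lambda : set R) :
  ~ (exists2 A : set R, is_arith_prog A & Lambda `<=` A) ->
  uniqueness_set (@L2 R) (rotation theta @` ([set: R] `*` Lambda)).
Proof.
move=> notAP f h f2 h2 fh.
pose W (u : R -> R[i]) (t : R) := u t * (gauss_window t)%:C.
pose al : R[i] := (2 * pi)%:C * expi (- theta).
have al0 : al != 0.
  rewrite mulf_neq0//; first by rewrite -normc_gt0 normc_real normr_gt0 gt_eqF// mulr_gt0 ?pi_gt0.
  by rewrite -cexp_imag cexp_neq0.
have Wr u : L2 u -> rapidC (W u) by exact: rapidC_L2.
have We u : L2 u -> entire (fun z => laplace (W u) (al * z)).
  by move=> /Wr/entire_laplace/entire_scale; exact.
have [|tau tau1 tauE] := entire_phase_retrieval (We f f2) (We h h2) notAP.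
  move=> x l Ll; apply/(normr_gabor_eq _ _ _ f2 h2); apply: fh.
  by exists (x, l).
exists tau; first by rewrite normr_normc tau1.
(* Once [G] has zero transform, it vanishes almost everywhere, and the positive window can be
   divided out. *)
pose G t := W f t - W h t * tau.
have Gr : rapidC G.
  have [[fr fi] [hr hi]] := (Wr f f2, Wr h h2).
  have [kr ki] : rapidC (fun t => W h t * tau).
    apply: (@rapidCM _ _ _ (nc tau) 0) => // t.
    by rewrite mul0r expR0 mulr1.
  split.
    by under eq_fun do rewrite Re_add Re_opp; exact: rapidB.
  by under eq_fun do rewrite Im_add Im_opp; exact: rapidB.
have G0 z : laplace G z = 0.
  have fc := rapidC_integrable (rapidC_cexp z (Wr f f2)).
  have hc := rapidC_integrable (rapidC_cexp z (Wr h h2)).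
  rewrite /laplace (_ : (fun t => _) = (fun t => W f t * cexp (t%:C * z) -
    W h t * cexp (t%:C * z) * tau)); last first.
    by apply/funext => t; rewrite /G mulrBl; congr (_ - _); ring.
  rewrite cintegralB//; last exact: integrableCZ.
  (* The factor [al^-1] undoes the rotation and scaling of the argument. *)
  rewrite cintegralZ//; have := tauE (al^-1 * z).
  by rewrite mulVKf// => E; rewrite -/(laplace _ _) -/(laplace _ _) E mulrC subrr.
have := laplace_inj Gr G0; apply: filterS; first exact: (ae_filter_ringOfSetsType mu).
move=> t /eqP; rewrite subr_eq0 /W mulrAC => /eqP/mulIf E.
rewrite mulrC; apply: E.
by rewrite -normc_gt0 normc_real normr_gt0 gt_eqF ?expR_gt0.
Qed.

End Gabor.

(** * Failure of uniqueness on an arithmetic progression *)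

Section Counterexample.
Variable R : realType.
Local Notation mu := (@lebesgue_measure R).

Lemma sin_intr_pi (k : int) : sin (k%:~R * pi) = 0 :> R.
Proof.
have N n : sin (n%:R * pi) = 0 :> R.
  elim: n => [|n IH]; first by rewrite mul0r sin0.
  by rewrite -natr1 mulrDl mul1r sinDpi IH oppr0.
case: k => n; first exact: N.
by rewrite NegzE mulrNz mulNr sinN N oppr0.
Qed.

Lemma L2_gauss_mul (phi : R -> R[i]) (C b : R) :
  measurable_fun [set: R] (fun t => Re (phi t)) ->
  measurable_fun [set: R] (fun t => Im (phi t)) ->
  (forall t, nc (phi t) <= C * expR (b * `|t|)) ->
  L2 (fun t => (gauss_window t)%:C * phi t).
Proof.
move=> mr mi phib.
have mg : measurable_fun [set: R] (@gauss_window R).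
  by have /rapid_measurable := rapid_gaussian (@pi_gt0 R); exact.
have mr' : measurable_fun [set: R] (fun t => Re ((gauss_window t)%:C * phi t)).
  by under eq_fun do rewrite Re_mul/= mul0r subr0; exact: measurable_funM.
have mi' : measurable_fun [set: R] (fun t => Im ((gauss_window t)%:C * phi t)).
  by under eq_fun do rewrite Im_mul/= mul0r addr0; exact: measurable_funM.
split=> //.
have p20 : 0 < 2 * pi :> R by rewrite mulr_gt0 ?pi_gt0.
have g2 := rapid_gaussian p20 (2 * b).
have /integrableP[_] : integrableR (fun t => nc ((gauss_window t)%:C * phi t) ^+ 2).
  apply: integrableR_le (integrableRZ (C ^+ 2) g2).
    by under eq_fun do rewrite sqr_normcE; apply: measurable_funD; exact: measurable_funX.
  move=> t; rewrite ger0_norm ?sqr_ge0// ComplexField.Normc.normcM normc_real.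
  rewrite ger0_norm ?expR_ge0//.
  have -> : C ^+ 2 * (expR (- (2 * pi * t ^+ 2)) * expR (2 * b * `|t|)) =
      (gauss_window t * (C * expR (b * `|t|))) ^+ 2.
    rewrite /gauss_window [in RHS]mulrCA exprMn; congr (_ * _).
    by rewrite -!expRD -expRM_natl; congr expR; ring.
  have Ce0 : 0 <= C * expR (b * `|t|) by apply: le_trans (phib t); exact: normc_ge0.
  have gw0 : 0 <= gauss_window t :> R by exact: expR_ge0.
  rewrite lerXn2r// ?nnegrE; last exact: ler_wpM2l.
    by apply: mulr_ge0; rewrite ?normc_ge0.
  exact: mulr_ge0.
apply: le_lt_trans; rewrite le_eqVlt; apply/orP; left; apply/eqP.
by apply: eq_integral => t _ /=; rewrite ger0_norm ?sqr_ge0.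
Qed.

(* The transform of [gauss_perturb k v] at Z is Psi Z + k Psi (Z + v), where Psi is
   the transform of a Gaussian. *)
Definition gauss_perturb (k v : R[i]) (t : R) : R[i] :=
  (gauss_window t)%:C * (1 + cexp (t%:C * v) * k).

Lemma L2_gauss_perturb k v : L2 (gauss_perturb k v).
Proof.
apply: (@L2_gauss_mul _ (1 + nc k) (nc v)).
- under eq_fun do rewrite Re_add Re_mul; apply: measurable_funD => //.
  by apply: measurable_funB; apply: measurable_funM => //;
    [exact: measurable_Re_cexp | exact: measurable_Im_cexp].
- under eq_fun do rewrite Im_add Im_mul; apply: measurable_funD => //.
  by apply: measurable_funD; apply: measurable_funM => //;
    [exact: measurable_Re_cexp | exact: measurable_Im_cexp].
move=> t; apply: le_trans (le_normcD _ _) _.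
rewrite mulrDl lerD//.
  by rewrite ComplexField.Normc.normc1 mul1r -expR0 ler_expR mulr_ge0 ?normc_ge0.
rewrite ComplexField.Normc.normcM mulrC ler_wpM2l ?normc_ge0//.
rewrite normc_cexp ler_expR (le_trans (ler_norm _))// (le_trans (normr_Re_le _))//.
by rewrite ComplexField.Normc.normcM normc_real mulrC.
Qed.

Lemma laplace_gauss_perturb k v z :
  laplace (fun t => gauss_perturb k v t * (gauss_window t)%:C) z =
  laplace (@gaussian2 R) z + laplace (@gaussian2 R) (z + v) * k.
Proof.
have i1 := rapidC_integrable (rapidC_cexp z (@rapidC_gaussian2 R)).
have i2 := rapidC_integrable (rapidC_cexp (z + v) (@rapidC_gaussian2 R)).
rewrite /laplace -cintegralZ// -cintegralD//; last exact: integrableCZ.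
congr cintegral; apply/funext => t.
have -> : gaussian2 t = (gauss_window t)%:C * (gauss_window t)%:C.
  by rewrite -rmorphM/= /gauss_window -expRD /gaussian2; congr (expR _)%:C; ring.
by rewrite /gauss_perturb (mulrDr t%:C) cexpD; ring.
Qed.

Lemma not_gabor_uniqueness (theta a b : R) (Lambda : set R) : a != 0 ->
  Lambda `<=` arith_prog a b ->
  ~ uniqueness_set (@L2 R) (rotation theta @` ([set: R] `*` Lambda)).
Proof.
move=> a0 LAP uniq.
pose Psi := laplace (@gaussian2 R).
(* Chosen so that Z v / (4 pi) = (pi / a) (x - i l) for Z = [laplace_arg theta x l]. *)
pose v : R[i] := (2 * pi / a)%:C * expi theta.
(* The quotient of values of [Psi] cancels the constants of [laplace_gaussian2D]; the phase makes
   the ratio real on the line l = b. *)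
pose g : R[i] := Psi 0 / Psi v * expi (pi / a * b).
have Psi0 z : Psi z != 0 by exact: laplace_gaussian2_neq0.
have gE z : Psi (z + v) * g = Psi z * (cexp (z * v / (4 * pi)%:C) * expi (pi / a * b)).
  have := laplace_gaussian2D z v; rewrite -/Psi => E.
  rewrite /g mulrA; have -> : Psi (z + v) * (Psi 0 / Psi v) = Psi (z + v) * Psi 0 / Psi v.
    by rewrite mulrA.
  by rewrite E; field; exact: Psi0.
pose ii : R[i] := 'i%C.
have LE (s : R[i]) z : laplace (fun t => gauss_perturb (g * s) v t * (gauss_window t)%:C) z =
    Psi z * (1 + cexp (z * v / (4 * pi)%:C) * expi (pi / a * b) * s).
  by rewrite laplace_gauss_perturb -/Psi mulrA gE; ring.
have [||z [[x l] /= [_ Ll] <-]|tau tau1 fh] :=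
    uniq (gauss_perturb (g * ii) v) (gauss_perturb (g * - ii) v).
- exact: L2_gauss_perturb.
- exact: L2_gauss_perturb.
- apply/normr_gabor_eq; [exact: L2_gauss_perturb | exact: L2_gauss_perturb |].
  rewrite !LE !ComplexField.Normc.normcM; congr (_ * _).
  have [k _ kl] := LAP _ Ll.
  (* For l = a k + b the total phase is - k pi, so the ratio is real. *)
  have -> : cexp (laplace_arg theta x l * v / (4 * pi)%:C) * expi (pi / a * b) =
      (expR (pi / a * x) * cos (k%:~R * pi))%:C.
    have thE : expi (- theta) * expi theta = 1 :> R[i].
      by rewrite -!cexp_imag -cexpD -mulrDr -rmorphD/= addNr mulr0 cexp0.
    have -> : laplace_arg theta x l * v / (4 * pi)%:C =
        (pi / a * x)%:C + ii * (- (pi / a * l))%:C.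
      transitivity ((2 * pi)%:C * (2 * pi / a)%:C / (4 * pi)%:C *
        (expi (- theta) * expi theta) * (x%:C - ii * l%:C)).
        by rewrite /laplace_arg /v -/ii; ring.
      rewrite thE mulr1 -fmorphV -!rmorphM/=.
      have -> : 2 * pi * (2 * pi / a) / (4 * pi) = pi / a :> R.
        by have := @pi_gt0 R; move: (@pi R) => p p0; field; rewrite a0 gt_eqF.
      by rewrite mulrBr rmorphN !rmorphM/=; ring.
    rewrite cexpD cexp_real cexp_imag -mulrA -!cexp_imag -cexpD -mulrDr -rmorphD/=.
    have -> : - (pi / a * l) + pi / a * b = - (k%:~R * pi).
      by rewrite -kl; move: (@pi R) => p; field.
    by rewrite cexp_imag /expi cosN sinN sin_intr_pi oppr0 complexr0 -rmorphM.
  move: (_ * cos _) => r.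
  (* For real [r] the numbers 1 + i r and 1 - i r are conjugate. *)
  rewrite -[LHS]normc_conjc; congr nc.
  by rewrite /ii; apply: complex_eqP;
    rewrite ?Re_conjc ?Im_conjc !(Re_add, Im_add, Re_mul, Im_mul, Re_opp, Im_opp)/=; ring.
have v0 : v != 0.
  rewrite mulf_neq0//; last by rewrite -cexp_imag cexp_neq0.
  rewrite -normc_eq0 normc_real normr_eq0 mulf_neq0 ?invr_eq0//.
  by rewrite gt_eqF// mulr_gt0 ?pi_gt0.
(* At this point the ratio equals i, so the first transform vanishes while the second is 2 Psi z,
   which is nonzero. Proportionality would force [tau = 0]. *)
pose z : R[i] := ii * (pi / 2 - pi / a * b)%:C * (4 * pi)%:C / v.
have zE : cexp (z * v / (4 * pi)%:C) * expi (pi / a * b) = ii.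
  have p40 : (4 * pi)%:C != 0 :> R[i].
    by rewrite -normc_eq0 normc_real normr_eq0 gt_eqF// mulr_gt0 ?pi_gt0.
  rewrite /z divfK// mulfK// -cexp_imag -cexpD -mulrDr -rmorphD/= subrK cexp_imag.
  by rewrite /expi cos_pihalf sin_pihalf.
have fW k : integrableC (fun t => gauss_perturb k v t * (gauss_window t)%:C * cexp (t%:C * z)).
  by apply/rapidC_integrable/rapidC_cexp/rapidC_L2; exact: L2_gauss_perturb.
have : laplace (fun t => gauss_perturb (g * ii) v t * (gauss_window t)%:C) z =
    laplace (fun t => gauss_perturb (g * - ii) v t * (gauss_window t)%:C) z * tau.
  rewrite /laplace -cintegralZ//; apply: cintegral_ae_eq => //.
    exact: integrableCZ.
  move: fh; apply: filterS; first exact: (ae_filter_ringOfSetsType mu).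
  by move=> t ->; ring.
rewrite !LE zE mulrN.
have -> : ii * ii = -1 by rewrite -expr2 /ii sqr_i.
rewrite subrr mulr0 opprK => /esym/eqP.
rewrite !mulf_eq0 (negbTE (Psi0 z))/= => /orP[|].
  by rewrite -[1 + 1]/(2%:R) pnatr_eq0.
move=> /eqP tau0; move: tau1; rewrite tau0 normr0 => /eqP.
by rewrite eq_sym oner_eq0.
Qed.

End Counterexample.

Theorem theorem1p2 (R : realType) (theta : R) (Lambda : set R) :
  uniqueness_set (@L2 R) (rotation theta @` ([set: R] `*` Lambda)) <->
  ~ (exists2 A : set R, is_arith_prog A & Lambda `<=` A).
Proof.
split=> [uniq [A [a [b ->]] LA]|]; last exact: gabor_uniqueness.
(* For [a = 0] the progression is the singleton of [b], which lies in the progression of step 1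
   through [b]. *)
have [a0|a0] := eqVneq a 0; last exact: not_gabor_uniqueness a0 LA uniq.
apply: (@not_gabor_uniqueness R theta 1 b Lambda) uniq; first exact: oner_neq0.
move=> l /LA[k _ <-]; exists 0 => //.
by rewrite a0 mul0r mulr0.
Qed.
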